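(* Let $r\in\{1,2,\dots\}$, $0<\delta<1$, $1\le s<\infty$, $\mu>2r-1/s+1/2$, $1\le p\le\infty$. Then for $N\asymp\left(\delta^{-1}\ln^{\mu}\frac1\delta\right)^{\frac{1}{\mu-1/p+1/s}}$ it holds $$N^{-\mu+2r-1/s+1/2}\preceq R^{(r,r)}_{N,\delta}(L^{\mu}_{s,2},L_2,\ell_p)\preceq N^{-\mu+2r-1/s+1/2}\ln^{\mu-2r+1}N$$ or $$\left(\delta\ln^{-\mu}\tfrac1\delta\right)^{\frac{\mu-2r+1/s-1/2}{\mu-1/p+1/s}}\preceq R^{(r,r)}_{N,\delta}(L^{\mu}_{s,2},L_2,\ell_p)\preceq\left(\delta\ln^{1/s-1/p}\tfrac1\delta\right)^{\frac{\mu-2r+1/s-1/2}{\mu-1/p+1/s}}\ln^{3/2-1/s}\tfrac1\delta .$$ The upper bound is realized by the hyperbolic-cross truncation method $\mathcal D^{(r,r)}_n$ for $n\asymp\left(\delta^{-1}\ln^{1/p-1/s}\frac1\delta\right)^{\frac{1}{\mu-1/p+1/s}}$.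
   Context: Let $\varphi_k(t)=\sqrt{k+1/2}\,(2^kk!)^{-1}\frac{d^k}{dt^k}[(t^2-1)^k]$, $k=0,1,2,\dots$, be the Legendre polynomials orthonormal on $[-1,1]$, $Q=[-1,1]^2$, $L_2=L_2(Q)$, $\varphi_{k,j}(t,\tau)=\varphi_k(t)\varphi_j(\tau)$, and $\langle f,\varphi_{k,j}\rangle=\int_{-1}^1\int_{-1}^1 f(t,\tau)\varphi_k(t)\varphi_j(\tau)\,d\tau\,dt$ (Fourier-Legendre coefficients). $\ell_p$ is the space of double sequences $(x_{k,j})_{k,j\ge0}$ with norm $(\sum|x_{k,j}|^p)^{1/p}$ (supremum if $p=\infty$). The space $L^\mu_{s,2}$ consists of $f\in L_2(Q)$ with $\|f\|_{s,\mu}^s:=\sum_{k,j\ge0}(\underline{k\cdot j})^{s\mu}|\langle f,\varphi_{k,j}\rangle|^s<\infty$, where $\underline{m}=\max\{1,m\}$; the class $L^\mu_{s,2}$ is its unit ball $\|f\|_{s,\mu}\le1$. The mixed derivative is understood as the series $f^{(r,r)}(t,\tau)=\sum_{k,j\ge r}\langle f,\varphi_{k,j}\rangle\varphi_k^{(r)}(t)\varphi_j^{(r)}(\tau)$. Perturbed data: a sequence of numbers $\overline{f^\delta}=(\langle f^\delta,\varphi_{k,j}\rangle)_{k,j\ge0}$ is admissible for $f$ at level $\delta$, $0<\delta<1$, if $\|(\langle f-f^\delta,\varphi_{k,j}\rangle)_{k,j\ge0}\|_{\ell_p}\le\delta$. For a finite set $\Omega$ of integer points of $[r,\infty)\times[r,\infty)$,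 $G(\Omega,\overline{f^\delta})=(\langle f^\delta,\varphi_{k,j}\rangle)_{(k,j)\in\Omega}$, and $\Psi(\Omega)$ is the set of all mappings $\psi:\mathbb R^{\mathrm{card}(\Omega)}\to L_2$ (neither linearity nor stability is required). The error of $\psi\in\Psi(\Omega)$ is $$\varepsilon_\delta(L^\mu_{s,2},\psi,L_2,\ell_p)=\sup_{\|f\|_{s,\mu}\le1}\ \sup_{\overline{f^\delta}\text{ admissible for }f}\|f^{(r,r)}-\psi(G(\Omega,\overline{f^\delta}))\|_{L_2},$$ and the minimal radius of Galerkin information is $R^{(r,r)}_{N,\delta}(L^\mu_{s,2},L_2,\ell_p)=\inf_{\Omega:\,\mathrm{card}(\Omega)\le N}\ \inf_{\psi\in\Psi(\Omega)}\varepsilon_\delta(L^\mu_{s,2},\psi,L_2,\ell_p)$. The truncation method is $\mathcal D_n^{(r,r)}f^\delta(t,\tau)=\sum_{k,j\ge r,\ kj\le rn-1}\langle f^\delta,\varphi_{k,j}\rangle\varphi_k^{(r)}(t)\varphi_j^{(r)}(\tau)$. Notation: for positive quantities, $a\preceq b$ means that there is a constant $c>0$ with $a\le cb$, and $a\asymp b$ means $a\preceq b$ and $b\preceq a$; constants may depend only on basic parameters such as $\mu,r,p,s$. $\ln^a x=(\ln x)^a$. *)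

(* Defs.v *)
From HB Require Import structures.
From mathcomp Require Import all_boot all_order all_algebra finmap.
From mathcomp Require Import all_classical all_reals all_analysis.
Set Implicit Arguments.
Unset Strict Implicit.
Unset Printing Implicit Defensive.
Import Order.TTheory GRing.Theory Num.Theory.
Import numFieldNormedType.Exports.
Local Open Scope classical_set_scope.
Local Open Scope ring_scope.

(* Orthonormal Legendre polynomial, by the Rodrigues formula. *)
Definition legendre (R : realType) (k : nat) : {poly R} :=
  (Num.sqrt (k%:R + 2^-1) / (2 ^+ k * k`!%:R)) *: (('X^2 - 1) ^+ k)^`(k).

Definition square (R : realType) : set (R * R) :=
  `[-1, 1]%classic `*` `[-1, 1]%classic.
Arguments square : clear implicits.

Definition leb2 (R : realType)
  : {measure set (measurableTypeR R * measurableTypeR R) -> \bar R} :=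
  (@lebesgue_measure R \x @lebesgue_measure R)%E.

(* A function on the square is represented by any function on the plane; only
   its values on the square matter, since it is extended by zero ([\_]). *)
Definition inL2 (R : realType) (f : R * R -> R) : Prop :=
  f \_ (square R) \in Lfun (leb2 R) 2%:E.

Definition normL2 (R : realType) (f : R * R -> R) : \bar R :=
  'N[leb2 R]_(2%:E)[EFin \o (f \_ (square R))].

(* phi_k^(r)(t) phi_j^(r)(tau), with the index pair [i = (k, j)] *)
Definition legendre2 (R : realType) (r : nat) (i : nat * nat) (z : R * R) : R :=
  ((legendre R i.1)^`(r)).[z.1] * ((legendre R i.2)^`(r)).[z.2].

Definition coef (R : realType) (f : R * R -> R) (i : nat * nat) : R :=
  \int[leb2 R]_(z in square R) (f z * legendre2 0 i z).

(* 1/p, with 1/oo = 0 *)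
Definition recip (R : realType) (p : \bar R) : R :=
  if p is p'%:E then p'^-1 else 0.

Definition lp_norm (R : realType) (p : \bar R) (x : nat * nat -> R) : \bar R :=
  if p is p'%:E
  then ((\esum_(i in [set: nat * nat]) (`|x i| `^ p')%:E) `^ p'^-1)%E
  else ereal_sup [set (`|x i|)%:E | i in [set: nat * nat]].

Definition smooth_norm (R : realType) (s mu : R) (f : R * R -> R) : \bar R :=
  ((\esum_(i in [set: nat * nat])
      (((maxn 1 (i.1 * i.2))%:R `^ (s * mu)) * `|coef f i| `^ s)%:E)
    `^ s^-1)%E.

Definition smooth_class (R : realType) (s mu : R) (f : R * R -> R) : Prop :=
  inL2 f /\ (smooth_norm s mu f <= 1)%E.

(* [h] is the sum in L_2, over the unordered index set {(k, j) | k, j >= r}, of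
   the series defining the mixed derivative f^(r,r). *)
Definition is_mixed_deriv (R : realType) (r : nat) (f h : R * R -> R) : Prop :=
  inL2 h /\
  forall e : R, 0 < e -> exists A0 : {fset nat * nat},
    forall A : {fset nat * nat}, (A0 `<=` A)%fset ->
      (normL2 (fun z => (h z -
         \sum_(i <- A | (r <= i.1)%N && (r <= i.2)%N)
            coef f i * legendre2 r i z)%R)
       <= e%:E)%E.

(* The L_2-distance from f^(r,r) to [v]: the sum [h] is unique up to a null set,
   so at most one value is in the set below, and the distance is +oo when the
   series diverges. *)
Definition mixed_deriv_dist (R : realType) (r : nat) (f v : R * R -> R) : \bar R :=
  ereal_inf [set normL2 (fun z => h z - v z) | h in is_mixed_deriv r f].

Definition admissible (R : realType) (p : \bar R) (delta : R)
    (f : R * R -> R) (x : nat * nat -> R) : Prop :=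
  (lp_norm p (fun i => coef f i - x i)%R <= delta%:E)%E.

Definition galerkin (R : realType) (Omega : {fset nat * nat})
    (x : nat * nat -> R) : {ffun Omega -> R} := [ffun i => x (val i)].

Definition method_error (R : realType) (r : nat) (s mu : R) (p : \bar R)
    (delta : R) (Omega : {fset nat * nat})
    (psi : {ffun Omega -> R} -> R * R -> R) : \bar R :=
  ereal_sup [set e | exists (f : R * R -> R) (x : nat * nat -> R),
    [/\ smooth_class s mu f, admissible p delta f x &
        e = mixed_deriv_dist r f (psi (galerkin Omega x))]].

Definition galerkin_radius (R : realType) (r : nat) (s mu : R) (p : \bar R)
    (N : nat) (delta : R) : \bar R :=
  ereal_inf [set e | exists (Omega : {fset nat * nat})
                            (psi : {ffun Omega -> R} -> R * R -> R),
    [/\ forall i, i \in Omega -> (r <= i.1)%N && (r <= i.2)%N,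
        (#|` Omega| <= N)%N,
        forall c, inL2 (psi c) &
        e = method_error r s mu p delta psi]].

(* Since r >= 1, every index pair satisfying k, j >= r and k j <= r n - 1 has
   k, j <= r n, so the enumeration misses none of them. *)
Definition hyperbolic_cross (r n : nat) : {fset nat * nat} :=
  [fset i in [seq (k, j) | k <- iota 0 (r * n).+1, j <- iota 0 (r * n).+1]
    | [&& r <= i.1, r <= i.2 & i.1 * i.2 <= r * n - 1]%N]%fset.

(* The truncation method D_n^(r,r), as a function of the Galerkin information
   on the hyperbolic cross. *)
Definition truncation (R : realType) (r n : nat)
    (c : {ffun hyperbolic_cross r n -> R}) (z : R * R) : R :=
  \sum_(i : hyperbolic_cross r n) c i * legendre2 r (val i) z.

(* Main.v *)
(** Upper bound. Integration by parts shows that the r-th derivative of the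
    k-th orthonormal Legendre polynomial has L_2-norm O(k ^ (2 r - 1/2)). With
    this bound the condition on mu makes the series of the mixed derivative
    absolutely convergent in L_2, so the triangle inequality alone suffices:
    Hoelder's inequality and counting in the hyperbolic cross k j < M = r n bound
    the tail by M ^ (- b) ln ^ (1 - 1/s) M, with b = mu - 2 r + 1/s - 1/2, and
    the propagated noise by delta M ^ (2 r - 1/2) (M ln M) ^ (1 - 1/p). Both are
    of order Y ^ (- b) ln ^ (1 - 1/s) (1 / delta) when n has order Y, which is
    better than required by a factor ln ^ (1/2) (1 / delta).

    Lower bound. Given N forbidden index pairs, at least N of the pairs (k, r)
    with N + r <= k < 3 N + r are free. A small multiple of the sum of the
    corresponding products of Legendre polynomials lies in the class, and its
    data vanish. Its derivative is large: the value at the end point 1 of the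
    r-th derivative of the k-th polynomial has order k ^ (2 r + 1/2), and a
    polynomial g of degree less than n satisfies |g(1)| <= n ||g||. *)

Require Import Defs.
From HB Require Import structures.
From mathcomp Require Import all_boot all_order all_algebra finmap.
From mathcomp Require Import all_classical all_reals all_analysis.
From mathcomp Require Import measurable_realfun.
From mathcomp Require Import ring lra zify.
Set Implicit Arguments.
Unset Strict Implicit.
Unset Printing Implicit Defensive.
Import Order.TTheory GRing.Theory Num.Theory.
Import numFieldNormedType.Exports.
Local Open Scope classical_set_scope.
Local Open Scope ring_scope.

(** * Legendre polynomials *)

(** Write L for ln (1 / delta), and X, Y for the orders prescribed for N and n. They are tied by X =
    Y L: a hyperbolic cross with n of order Y has at most about n ln n points, that is Y L = X, so N
    data of order X pay for it. Y is the value at which tail and noise balance, in the form delta =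
    Y ^ (- a) L ^ (1/p - 1/s).

    The constants must be uniform over 0 < delta < 1, although L tends to 0 as delta tends to 1.
    This is possible because N is a natural number: 1 <= N <= c2 X keeps X, and hence L, away from
    0, and additive constants can then be absorbed in multiples of L. In terms of N the absorbing
    quantity is ln N, which vanishes at N = 1; this is why the upper bound in terms of N asks for N
    > 1.

    The lower bound uses exact data, which are admissible at every level, so its constant depends
    neither on delta nor on p. *)

Section PolyIntegral.
Variable R : realType.
Implicit Types p q : {poly R}.

Definition pint p : R := \int[lebesgue_measure]_(x in `[-1, 1]) p.[x].

(** Once an integrand is written as a derivative, linearity of [pint] becomes an identity between
    end-point values, without integrability side conditions. The coefficient at i = 0 is p_0 / 0 =
    0, a harmless choice of the constant term. *)
Lemma poly_primitive p : exists P : {poly R}, P^`() = p.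
Proof.
exists (\poly_(i < (size p).+1) (p`_i.-1 / i%:R)).
apply/polyP => i; rewrite coef_deriv coef_poly ltnS.
case: ltnP => [_|hi]; last by rewrite mul0rn nth_default.
by rewrite /= -[LHS]mulr_natr divfK ?pnatr_eq0.
Qed.

Lemma integral_horner_deriv p :
  (\int[lebesgue_measure]_(x in `[(-1)%R, 1%R]) (p^`().[x])%:E
   = (p.[1] - p.[-1])%:E)%E.
Proof.
rewrite EFinB; apply: continuous_FTC2; first by rewrite gtrN.
- by apply: continuous_subspaceT; exact: continuous_horner.
- split.
  + by move=> x _; exact: derivable_horner.
  + by apply: cvg_at_right_filter; exact: continuous_horner.
  + by apply: cvg_at_left_filter; exact: continuous_horner.
- by move=> x _; rewrite -derivE.
Qed.

Lemma pint_deriv p : pint p^`() = p.[1] - p.[-1].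
Proof. by rewrite /pint /Rintegral integral_horner_deriv. Qed.

Lemma integral_itv_horner p :
  (\int[lebesgue_measure]_(x in `[(-1)%R, 1%R]) (p.[x])%:E = (pint p)%:E)%E.
Proof.
have [P <-] := poly_primitive p.
by rewrite integral_horner_deriv pint_deriv.
Qed.

Lemma pintD p q : pint (p + q) = pint p + pint q.
Proof.
have [[P <-] [Q <-]] := (poly_primitive p, poly_primitive q).
by rewrite -derivD !pint_deriv !hornerD; ring.
Qed.

Lemma pintZ a p : pint (a *: p) = a * pint p.
Proof.
have [P <-] := poly_primitive p.
by rewrite -derivZ !pint_deriv !hornerZ; ring.
Qed.

Lemma pintN p : pint (- p) = - pint p.
Proof. by rewrite -scaleN1r pintZ mulN1r. Qed.

Lemma pintB p q : pint (p - q) = pint p - pint q.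
Proof. by rewrite pintD pintN. Qed.

Lemma pint0 : pint 0 = 0.
Proof. by rewrite -(scale0r 0) pintZ mul0r. Qed.

Lemma pint_sum (I : Type) (s : seq I) (P : pred I) (F : I -> {poly R}) :
  pint (\sum_(i <- s | P i) F i) = \sum_(i <- s | P i) pint (F i).
Proof. by apply: (big_morph pint pintD pint0). Qed.

Lemma pint_sqr_ge0 p : 0 <= pint (p * p).
Proof.
rewrite -lee_fin -integral_itv_horner; apply: integral_ge0 => x _.
by rewrite lee_fin hornerM -expr2 sqr_ge0.
Qed.

Lemma pint_parts p q :
  pint (p^`() * q) = p.[1] * q.[1] - p.[-1] * q.[-1] - pint (p * q^`()).
Proof.
have := pint_deriv (p * q); rewrite derivM pintD !hornerM => <-.
by rewrite addrK.
Qed.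

Lemma derivn_sum (J : Type) (t : seq J) (F : J -> {poly R}) n :
  (\sum_(k <- t) F k)^`(n) = \sum_(k <- t) (F k)^`(n).
Proof.
apply: (big_morph (fun p : {poly R} => p^`(n))) => [p q|]; first exact: derivnD.
by rewrite -polyC0 derivnC; case: eqP.
Qed.

Lemma derivn_comp_shift p c n : p^`(n) \Po ('X + c%:P) = (p \Po ('X + c%:P))^`(n).
Proof.
elim: n => [|n IH]; first by rewrite !derivn0.
by rewrite !derivnS -IH deriv_comp derivD derivX derivC addr0 mulr1.
Qed.

Lemma horner_derivn p c n :
  p^`(n).[c] = (p \Po ('X + c%:P))`_n * n`!%:R.
Proof.
have -> : p^`(n).[c] = (p^`(n) \Po ('X + c%:P)).[0].
  by rewrite horner_comp !hornerE.
by rewrite derivn_comp_shift horner_coef0 coef_derivn addn0 ffactnn mulr_natr.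
Qed.

(** For c = 1 or c = -1 one has t^2 - 1 = (t - c)(t + c), so the shift by c gives X^k (2 c + X)^k;
    the derivative at c is n! times a Taylor coefficient, read off the binomial formula. *)
Lemma horner_derivn_bump k n c : c ^+ 2 = 1 ->
  ((('X^2 - 1 : {poly R}) ^+ k)^`(n)).[c] =
  (if (n < k)%N then 0%R else 'C(k, n - k)%:R * (2 * c) ^+ (k - (n - k))) * n`!%:R.
Proof.
move=> c2; rewrite horner_derivn; congr (_ * _).
have -> : (('X^2 - 1 : {poly R}) ^+ k) \Po ('X + c%:P)
         = ((2 * c)%:P + 'X) ^+ k * 'X^k.
  rewrite rmorphXn /= -exprMn; congr (_ ^+ _).
  have e : 1%:P = c%:P * c%:P :> {poly R} by rewrite -polyCM -expr2 c2.
  rewrite comp_polyB comp_Xn_poly -[X in X \Po _]/(1%:P) comp_polyC e.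
  by rewrite mulr_natl mulr2n polyCD; ring.
rewrite coefMXn; case: ltnP => // hkn.
rewrite exprDn coef_sum.
have [hn|hn] := ltnP (n - k) k.+1; last first.
  rewrite bin_small // mul0r big1 // => i _.
  rewrite coefMn -polyC_exp coefCM coefXn gtn_eqF ?mulr0 ?mul0rn //.
  by apply: leq_trans hn; rewrite ltnS -ltnS.
rewrite (bigD1 (Ordinal hn)) //= big1 ?addr0; last first.
  move=> i; rewrite -val_eqE /= => hi.
  by rewrite coefMn -polyC_exp coefCM coefXn eq_sym (negPf hi) mulr0 mul0rn.
by rewrite coefMn -polyC_exp coefCM coefXn eqxx mulr1 -[LHS]mulr_natl.
Qed.

Lemma pint_bump_derivn k j q : (j <= k)%N ->
  pint ((('X^2 - 1) ^+ k)^`(j) * q)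
  = (-1) ^+ j * pint (('X^2 - 1) ^+ k * q^`(j)).
Proof.
elim: j q => [|j IH] q hj; first by rewrite expr0 mul1r !derivn0.
(* The boundary terms vanish: a derivative of order j < k of (t^2 - 1)^k still has the factor t^2 -
   1. *)
rewrite derivnS pint_parts !horner_derivn_bump ?sqrrN ?expr1n // hj !mul0r.
rewrite subr0 sub0r IH; last exact: ltnW.
by rewrite -derivSn [(-1) ^+ j.+1]exprS mulN1r mulNr.
Qed.

(** Integrate the derivative of t (1 - t^2)^(k+1), which vanishes at both end points, and replace
    t^2 by 1 - (1 - t^2) in it. *)
Lemma pint_bumpS k : (k.*2.+3)%:R * pint ((1 - 'X^2) ^+ k.+1)
  = (k.*2.+2)%:R * pint ((1 - 'X^2) ^+ k).
Proof.
have := pint_deriv ('X * (1 - 'X^2) ^+ k.+1).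
rewrite !hornerE /= sqrrN expr1n subrr expr0n /= !mulr0 subrr => h.
have : pint (('X * (1 - 'X^2) ^+ k.+1)^`() ) =
  (k.*2.+3)%:R * pint ((1 - 'X^2) ^+ k.+1) - (k.*2.+2)%:R * pint ((1 - 'X^2) ^+ k).
  rewrite -!pintZ -pintB; congr pint.
  rewrite derivM derivX deriv_exp derivB derivXn derivC /= sub0r mul1r.
  rewrite -!mul_polyC !polyC_natr [(1 - 'X^2) ^+ k.+1]exprS.
  rewrite -[_ *+ k.+1]mulr_natl.
  rewrite -[k.*2.+3]addn3 -[k.*2.+2]addn2 -muln2 -[k.+1]addn1 !natrD natrM.
  ring.
by rewrite h => /eqP; rewrite eq_sym subr_eq0 => /eqP.
Qed.

Lemma pint_bump k : pint ((1 - 'X^2) ^+ k) * (k.*2.+1)`!%:R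
   = 2 * (2 ^+ k * k`!%:R) ^+ 2.
Proof.
elim: k => [|k IH].
  rewrite expr0 -[X in pint X](derivX R) pint_deriv !hornerX double0 factS !fact0.
  by ring.
have h := pint_bumpS k.
have e1 : (k.+1.*2.+1)`!%:R = (k.*2.+3)%:R * ((k.*2.+2)%:R * (k.*2.+1)`!%:R) :> R.
  by rewrite doubleS 2!factS !natrM.
rewrite e1 [k.+1`!]factS natrM [2 ^+ k.+1]exprS.
have e : (k.*2.+2)%:R = 2 * (k.+1)%:R :> R by rewrite -natrM mul2n doubleS.
rewrite [LHS](_ : _ = (k.*2.+3)%:R * pint ((1 - 'X^2) ^+ k.+1)
    * (k.*2.+2)%:R * (k.*2.+1)`!%:R); last by ring.
rewrite h [LHS](_ : _ = (k.*2.+2)%:R ^+ 2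
    * (pint ((1 - 'X^2) ^+ k) * (k.*2.+1)`!%:R)); last by ring.
by rewrite IH e; ring.
Qed.

(** Integrating by parts k times puts k derivatives on q, whose degree is less than k. *)
Lemma pint_legendre_lt k q : (size q <= k)%N -> pint (legendre R k * q) = 0.
Proof.
move=> hq; rewrite /legendre -scalerAl pintZ pint_bump_derivn //.
by rewrite derivn_poly0 // mulr0 pint0 !mulr0.
Qed.

Lemma coef_legendre k : (legendre R k)`_k =
  Num.sqrt (k%:R + 2^-1) / (2 ^+ k * k`!%:R) * ((k + k) ^_ k)%:R.
Proof.
rewrite /legendre coefZ coef_derivn; congr (_ * _).
have -> : (('X^2 - 1 : {poly R}) ^+ k)`_(k + k) = 1; last by [].
have h : lead_coef ('X^2 - 1%:P : {poly R}) = 1.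
  by rewrite -[RHS](lead_coefXnsubC (1 : R) (isT : (0 < 2)%N)).
have hs : size ('X^2 - 1%:P : {poly R}) = 3%N.
  by rewrite size_XnsubC.
have := lead_coef_exp ('X^2 - 1%:P : {poly R}) k.
rewrite h expr1n lead_coefE size_exp hs /= mul2n addnn => <-.
by rewrite polyC1.
Qed.

Lemma size_legendre k : (size (legendre R k) <= k.+1)%N.
Proof.
rewrite /legendre; apply: (leq_trans (size_scale_leq _ _)).
apply/leq_sizeP => j hj; rewrite coef_derivn nth_default ?mul0rn //.
apply: (leq_trans (size_exp_leq _ _)).
have -> : size ('X^2 - 1 : {poly R}) = 3%N by rewrite -polyC1 size_XnsubC.
by rewrite /= mul2n -addnn -addnS leq_add2l.
Qed.

Lemma legendre_norm k : pint (legendre R k * legendre R k) = 1.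
Proof.
have hfac n : n`!%:R != 0 :> R by rewrite pnatr_eq0 -lt0n fact_gt0.
have h2 : (2 : R) ^+ k != 0 by rewrite expf_neq0 // pnatr_eq0.
rewrite {1}/legendre -scalerAl pintZ pint_bump_derivn // .
(* The second factor receives all k derivatives and becomes constant, so the norm reduces to the
   leading coefficient times the integral of (1 - t^2)^k. *)
have -> : (legendre R k)^`(k) = ((legendre R k)`_k * k`!%:R)%:P.
  apply/polyP => i; rewrite coef_derivn coefC; case: i => [|i].
    by rewrite addn0 ffactnn mulr_natr.
  rewrite nth_default ?mul0rn //; apply: leq_trans (size_legendre k) _.
  by rewrite addnS ltnS leq_addr.
rewrite [X in pint X]mulrC mul_polyC pintZ.
have -> : (-1) ^+ k * ((legendre R k)`_k * k`!%:R * pint (('X^2 - 1) ^+ k))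
   = (legendre R k)`_k * k`!%:R * pint ((1 - 'X^2) ^+ k).
  rewrite mulrCA; congr (_ * _); rewrite -pintZ; congr pint.
  rewrite -mul_polyC rmorphXn /= -exprMn polyCN mulNr mul1r opprB. 
  by [].
have hb := pint_bump k.
have -> : pint ((1 - 'X^2) ^+ k) = 2 * (2 ^+ k * k`!%:R) ^+ 2 / (k.*2.+1)`!%:R.
  by rewrite -hb mulfK.
rewrite coef_legendre.
have hs : Num.sqrt (k%:R + 2^-1) ^+ 2 = k%:R + 2^-1 :> R.
  by rewrite sqr_sqrtr // addr_ge0 // invr_ge0.
have hff : ((k + k) ^_ k)%:R * k`!%:R = (k.*2)`!%:R :> R.
  by rewrite -natrM -addnn -(ffact_fact (leq_addr k k)) addnK.
have hf1 : (k.*2.+1)`!%:R = (2 * (k%:R + 2^-1)) * (k.*2)`!%:R :> R.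
  rewrite factS natrM -addn1 natrD -muln2 natrM; congr (_ * _).
  by field.
have hk : 2 * (k%:R + 2^-1) != 0 :> R.
  by rewrite mulf_neq0 // gt_eqF // ltr_wpDl // invr_gt0.
rewrite hf1 -hff; move: hk hs hff; set S := Num.sqrt _; set A := _ ^_ _.
move=> hk hs hff.
have hA : A%:R != 0 :> R.
  by apply: contraNneq (hfac (k.*2)) => hA; rewrite -hff hA mul0r.
rewrite -hs; have hS : S != 0.
  by apply: contraNneq hk => hS; rewrite -hs hS expr0n mulr0.
have := hfac k; move: (k`!%:R : R) (A%:R : R) hA h2 => F B hB.
move: (2 ^+ k : R) => P hP hF.
by field; rewrite hS hB hP hF.
Qed.

End PolyIntegral.

Section LegendreBounds.
Variable R : realType.
Implicit Types p q : {poly R}.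

Lemma leq_expn2r e m n : (m <= n)%N -> (m ^ e <= n ^ e)%N.
Proof. by case: e => // e mn; rewrite leq_exp2r. Qed.

Lemma ffact_le_exp n m : (n ^_ m <= n ^ m)%N.
Proof.
elim: m n => [|m IH] [|n] //.
rewrite ffactSS expnS leq_mul2l; apply/orP; right.
by apply: leq_trans (IH n) _; apply: leq_expn2r.
Qed.

Lemma exp_le_ffact n m : ((n.+1 - m) ^ m <= n ^_ m)%N.
Proof.
elim: m n => [|m IH] [|n] //; first by rewrite subSS sub0n exp0n.
rewrite ffactSS expnS subSS; apply: leq_mul; first by rewrite leq_subr.
exact: IH.
Qed.

(** By the Rodrigues formula this is a derivative of order k + i of (t^2 - 1)^k. The product of
    falling factorials is the classical (k + i)! / (k - i)!, split so that each factor has simple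
    power bounds. *)
Lemma horner_derivn_legendre k i c : c ^+ 2 = 1 -> (i <= k)%N ->
  (legendre R k)^`(i).[c] =
  Num.sqrt (k%:R + 2^-1) * c ^+ (k - i) * ((k ^_ i * (k + i) ^_ i)%:R / (2 ^+ i * i`!%:R)).
Proof.
move=> c2 ik; rewrite /legendre derivnZ hornerZ.
rewrite [X in X.[c]](_ : _ = (('X^2 - 1) ^+ k)^`(k + i)); last first.
  by rewrite addnC /derivn iterD.
rewrite horner_derivn_bump // ltnNge leq_addr /= addnC addnK exprMn.
have hfac n : n`!%:R != 0 :> R by rewrite pnatr_eq0 -lt0n fact_gt0.
have h2 n : (2 : R) ^+ n != 0 by rewrite expf_neq0 // pnatr_eq0.
have e1 : (i + k)`!%:R = ((i + k) ^_ i)%:R * k`!%:R :> R.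
  by rewrite -natrM -(ffact_fact (leq_addr k i)) [X in (X - i)%N]addnC addnK.
have e2 : (k ^_ i)%:R = 'C(k, i)%:R * i`!%:R :> R.
  by rewrite -natrM bin_ffact.
have e3 : (2 : R) ^+ k = 2 ^+ (k - i) * 2 ^+ i by rewrite -exprD subnK.
rewrite e1 e3 natrM e2.
move: (hfac k) (hfac i) (h2 i) (h2 (k - i)%N).
move: (k`!%:R : R) (i`!%:R : R) (2 ^+ i : R) (2 ^+ (k - i) : R) => A B C D hA hB hC hD.
by field; rewrite hA hB hC hD.
Qed.

(** Since i <= k, the factor (k + i) ^_ i is at most (2 k)^i, whose 2^i cancels the one in the
    denominator; for i > k the derivative is zero. *)
Lemma horner_derivn_legendre_le k i c : c ^+ 2 = 1 ->
  `|(legendre R k)^`(i).[c]| <= Num.sqrt (k%:R + 2^-1) * k%:R ^+ (2 * i).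
Proof.
move=> c2; have [ik|ki] := leqP i k; last first.
  rewrite derivn_poly0; last by apply: leq_trans (size_legendre R k) ki.
  by rewrite horner0 normr0 mulr_ge0 ?sqrtr_ge0 ?exprn_ge0.
have c1 : `|c| = 1.
  by apply/eqP; rewrite -(@eqrXn2 _ 2) // -normrX c2 normr1 expr1n.
rewrite horner_derivn_legendre // !normrM normrX c1 expr1n mulr1.
rewrite [X in X * _]ger0_norm ?sqrtr_ge0 //.
apply: ler_wpM2l; first exact: sqrtr_ge0.
rewrite normfV normrM !normr_nat normrX normr_nat.
rewrite ler_pdivrMr; last by rewrite mulr_gt0 ?exprn_gt0 ?ltr0n ?fact_gt0.
rewrite -!natrX -!natrM ler_nat mul2n -addnn expnD.
rewrite mulnA -[leqLHS]muln1.
apply: leq_mul; last exact: fact_gt0.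
rewrite -mulnA; apply: leq_mul; first exact: ffact_le_exp.
apply: leq_trans (ffact_le_exp _ _) _.
rewrite -expnMn; apply: leq_expn2r.
by rewrite muln2 -addnn leq_add2l.
Qed.

(** The gap M + i <= k makes every factor of both falling factorials at least M, which gives a bound
    uniform in k. *)
Lemma horner1_derivn_legendre_ge k i M : (M + i <= k)%N ->
  Num.sqrt (M%:R) * M%:R ^+ (2 * i) / (2 ^+ i * i`!%:R) <= (legendre R k)^`(i).[1].
Proof.
move=> hk; have ik : (i <= k)%N by apply: leq_trans hk; rewrite leq_addl.
rewrite horner_derivn_legendre ?expr1n // mulr1 mulrA.
have Mk : (M <= k)%N by apply: leq_trans hk; rewrite leq_addr.
rewrite ler_wpM2r //.
apply: ler_pM; rewrite ?sqrtr_ge0 ?exprn_ge0 //.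
  by rewrite ler_sqrt ?ler_wpDr ?ler_nat ?invr_ge0 // ltr_wpDl // invr_gt0.
rewrite -natrX ler_nat mul2n -addnn expnD; apply: leq_mul.
  apply: leq_trans (exp_le_ffact _ _); apply: leq_expn2r.
  by rewrite leq_subRL ?(leq_trans ik) // addnC ltnW.
apply: leq_trans (exp_le_ffact _ _); apply: leq_expn2r.
by rewrite -addSn addnK ltnW.
Qed.

Lemma pint_legendre_neq k l : k != l -> pint (legendre R k * legendre R l) = 0.
Proof.
rewrite neq_ltn => /orP[h|h]; last first.
  by apply: pint_legendre_lt; apply: leq_trans (size_legendre R l) h.
by rewrite mulrC; apply: pint_legendre_lt; apply: leq_trans (size_legendre R k) h.
Qed.

Lemma size_derivn_le p n : (size p^`(n) <= size p)%N.
Proof.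
elim: n => [|n IH]; first by rewrite derivn0.
rewrite derivnS; apply: leq_trans IH; set q := _^`(n).
have [->|q0] := eqVneq q 0; first by rewrite deriv0.
exact: ltnW (lt_size_deriv q0).
Qed.

(* Integrating by parts moves derivatives to the second factor until
   orthogonality kills the integral; the [2 a] end-point values remain. The
   truncated predecessor is harmless because [0 < b]. *)
Lemma pint_derivn_legendre_le k a b : (0 < b)%N ->
  `|pint ((legendre R k)^`(a) * (legendre R k)^`(b))|
  <= (2 * a)%:R * ((k%:R + 2^-1) * k%:R ^+ (2 * (a + b).-1)).
Proof.
elim: a b => [|a IH] b hb.
  rewrite derivn0 pint_legendre_lt ?normr0 ?muln0 ?mul0r //.
  case: b hb => // b _; have [->|hz] := eqVneq (legendre R k) 0.
    by rewrite -polyC0 derivnC size_poly0.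
  apply: leq_trans (_ : (size (legendre R k)^`() <= k)%N); last first.
    by rewrite -ltnS; apply: leq_trans (lt_size_deriv hz) (size_legendre R k).
  by rewrite derivSn; exact: size_derivn_le.
rewrite derivnS pint_parts -derivnS.
set B := (k%:R + 2^-1) * _.
have hB c : c ^+ 2 = 1 ->
   `|(legendre R k)^`(a).[c] * (legendre R k)^`(b).[c]| <= B.
  move=> c2; rewrite normrM.
  apply: le_trans (ler_pM (normr_ge0 _) (normr_ge0 _)
     (horner_derivn_legendre_le k a c2) (horner_derivn_legendre_le k b c2)) _.
  rewrite mulrACA -expr2 sqr_sqrtr ?addr_ge0 ?invr_ge0 // -exprD -mulnDr.
  by rewrite /B addSn /=.
(* The total order a + b is constant along the induction, so all boundary terms share the bound
   [B]. *)
have := IH b.+1 isT; rewrite addnS -addSn -/B => h.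
have h1 := hB 1 (expr1n _ _); have h2 := hB (-1) (etrans (sqrrN _) (expr1n _ _)).
rewrite mulnS natrD mulrDl -/B -[2 : R]/(1 + 1) mulrDl mul1r.
apply: le_trans (ler_normB _ _) _; apply: lerD => //.
by apply: le_trans (ler_normB _ _) _; apply: lerD.
Qed.

Lemma legendre_derivn_norm_le k r : (0 < k)%N -> (0 < r)%N ->
  pint ((legendre R k)^`(r) * (legendre R k)^`(r)) <= (4 * r)%:R * k%:R ^+ (4 * r - 1).
Proof.
move=> hk hr; apply: le_trans (ler_norm _) _.
apply: le_trans (pint_derivn_legendre_le k r hr) _.
have -> : (4 * r - 1 = (2 * (r + r).-1).+1)%N by lia.
have -> : (4 * r = 2 * r * 2)%N by lia.
rewrite [in leRHS]natrM exprS -!mulrA ler_wpM2l // mulrA ler_wpM2r ?exprn_ge0 //.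
(* Here k + 1/2 <= 2 k, which turns the constant 2 r into 4 r. *)
have : (1 : R) <= k%:R by rewrite ler1n.
lra.
Qed.

Lemma pint_sqrDZ p q a : pint ((p + a *: q) * (p + a *: q)) =
  pint (p * p) + 2 * a * pint (q * p) + a ^+ 2 * pint (q * q).
Proof.
rewrite [X in pint X](_ : _ = p * p + (2 * a) *: (q * p) + a ^+ 2 *: (q * q)).
  by rewrite !pintD !pintZ.
by rewrite -!mul_polyC polyCM rmorphXn /= polyC_natr; ring.
Qed.

(* A Nikolskii-type inequality at the end point. Split off the component along
   the top Legendre polynomial, whose value at 1 is sqrt(n + 1/2), and apply
   Cauchy-Schwarz to the two remaining terms. *)
Lemma horner1_sqr_le n q : (size q <= n)%N -> q.[1] ^+ 2 <= n%:R ^+ 2 * pint (q * q).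
Proof.
elim: n q => [|n IH] q hq.
  by move: hq; rewrite leqn0 size_poly_eq0 => /eqP ->; rewrite horner0 mul0r pint0 mulr0 expr0n.
set u := legendre R n; set a := q`_n / u`_n.
have hu : u`_n != 0.
  have hff : ((n + n) ^_ n)%:R != 0 :> R.
    by rewrite pnatr_eq0 -lt0n ffact_gt0 leq_addr.
  have hfac : n`!%:R != 0 :> R by rewrite pnatr_eq0 -lt0n fact_gt0.
  have h2 : (2 : R) ^+ n != 0 by rewrite expf_neq0 // pnatr_eq0.
  have hsq : Num.sqrt (n%:R + 2^-1) != 0 :> R.
    by rewrite gt_eqF // sqrtr_gt0 ltr_wpDl // invr_gt0.
  by rewrite coef_legendre !mulf_eq0 invr_eq0 mulf_eq0 !negb_or hff hfac h2 hsq.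
pose h := q - a *: u.
have hh : (size h <= n)%N.
  apply/leq_sizeP => j; rewrite leq_eqVlt => /orP[/eqP <-|hj].
    by rewrite coefB coefZ divfK // subrr.
  rewrite coefB coefZ !nth_default ?mulr0 ?subr0 //; first exact: leq_trans (size_legendre R n) hj.
  exact: leq_trans hq hj.
have := IH h hh.
have eq : q = h + a *: u by rewrite /h subrK.
have e1 : pint (q * q) = pint (h * h) + a ^+ 2.
  have uu : pint (u * u) = 1 by exact: legendre_norm.
  have uh : pint (u * h) = 0 by exact: pint_legendre_lt.
  by rewrite [in LHS]eq pint_sqrDZ uu uh; ring.
have e2 : q.[1] = h.[1] + a * u.[1] by rewrite {1}eq hornerD hornerZ.
have e3 : u.[1] ^+ 2 <= n%:R + 2^-1.
  have := horner_derivn_legendre_le n 0 (expr1n R 2).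
  rewrite derivn0 muln0 expr0 mulr1 => hu1.
  rewrite -real_normK ?num_real // -[leRHS]sqr_sqrtr ?addr_ge0 ?invr_ge0 //.
  by rewrite lerXn2r // ?nnegrE ?sqrtr_ge0.
have hH := pint_sqr_ge0 h.
rewrite e1 e2; move: e3 hH; set H := pint _; set x := h.[1]; set y := u.[1].
have hn : 0 <= n%:R :> R by [].
have -> : n.+1%:R = n%:R + 1 :> R by rewrite -addn1 natrD.
move: (n%:R : R) hn => S hS hy hH hx.
have [S0|hS0] := eqVneq S 0.
  have x0 : x = 0.
    apply/eqP; rewrite -sqrf_eq0 eq_le sqr_ge0 andbT.
    by apply: le_trans hx _; rewrite S0 expr0n mul0r.
  rewrite x0 S0 !add0r expr1n mul1r; move: hy; rewrite S0 => hy; nra.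
have hSp : 0 < S by rewrite lt_neqAle eq_sym hS0.
(* The cross term satisfies 2 x a y <= H y^2 + S^2 a^2, because x^2 <= S^2 H. With y^2 <= S + 1/2
   both H and a^2 get the factor S^2 + S + 1/2, which is below (S + 1)^2. *)
have k1 : 0 <= (x * y - S ^+ 2 * a) ^+ 2 by exact: sqr_ge0.
have k2 : (2 * x * a * y) * S ^+ 2 <= x ^+ 2 * y ^+ 2 + S ^+ 2 * S ^+ 2 * a ^+ 2 by nra.
have k3 : x ^+ 2 * y ^+ 2 <= (S ^+ 2 * H) * y ^+ 2 by rewrite ler_wpM2r ?sqr_ge0.
have k4 : 2 * x * a * y <= H * y ^+ 2 + S ^+ 2 * a ^+ 2.
  rewrite -(@ler_pM2r _ (S ^+ 2)) ?exprn_gt0 //; nra.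
have k5 : H * y ^+ 2 <= H * (S + 2^-1) by rewrite ler_wpM2l.
have k6 : a ^+ 2 * y ^+ 2 <= a ^+ 2 * (S + 2^-1) by rewrite ler_wpM2l ?sqr_ge0.
have k7 : 0 <= a ^+ 2 * S by rewrite mulr_ge0 ?sqr_ge0.
have k8 : 0 <= H * S by rewrite mulr_ge0.
have k9 := sqr_ge0 a.
nra.
Qed.

End LegendreBounds.

(** * Absolutely convergent series in L_2 *)

Section AbsolutelyConvergentL2.
Variable R : realType.

(* The limit superior is measurable in a parameter without any convergence
   assumption. *)
Definition esup_series (u : nat -> R) : R :=
  fine (limn_esup (fun N => (\sum_(0 <= n < N) u n)%:E)).

(** If the right side is finite, the series converges absolutely, [esup_series u] is its sum, and
    the remainder is a limit of finite tails. The square prepares for monotone convergence under the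
    integral. *)
Lemma esup_series_tail (u : nat -> R) m :
  (((esup_series u - \sum_(0 <= n < m) u n)%R ^+ 2)%:E
  <= limn (fun N => ((\sum_(m <= n < N) `|u n|)%R ^+ 2)%:E))%E.
Proof.
set S := fun N => \sum_(0 <= n < N) u n.
set g : nat -> R := fun N => \sum_(m <= n < N) `|u n|.
have g0 N : 0 <= g N by apply: sumr_ge0.
have gS N M : (N <= M)%N -> g N <= g M.
  move=> NM; rewrite /g; have [mN|Nm] := leqP m N.
    by rewrite [leRHS](big_cat_nat mN NM) /= lerDl sumr_ge0.
  by rewrite big_geq ?(ltnW Nm) // sumr_ge0.
pose G : nat -> \bar R := fun N => (g N ^+ 2)%:E.
have Gnd : {homo G : n m / (n <= m)%N >-> (n <= m)%E}.
  by move=> a b ab; rewrite lee_fin lerXn2r ?nnegrE // gS.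
have Gle N : (G N <= limn G)%E.
  rewrite (cvg_lim _ (ereal_nondecreasing_cvgn Gnd)) //.
  by apply: ereal_sup_ubound; exists N.
rewrite -/G; move: Gle; case E : (limn G) => [B| |] Gle; last 2 first.
- by rewrite leey.
- by have := Gle 0%N; rewrite leeNy_eq.
have gB N : g N ^+ 2 <= B by rewrite -lee_fin; exact: Gle.
have gB1 N : g N <= 1 + B by have := gB N; have := g0 N; nra.
have SE N : S N = series u N by rewrite /S /series.
have Sc : cvgn S.
  rewrite (_ : S = series u); last exact/funext.
  apply: normed_cvg; apply: nondecreasing_is_cvgn.
    apply: nondecreasing_series => n _ _; exact: normr_ge0.
  exists (\sum_(0 <= n < m) `|u n| + (1 + B)) => _ [N _ <-].
  change (\sum_(0 <= n < N) `|u n| <= \sum_(0 <= n < m) `|u n| + (1 + B)).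
  have [mN|Nm] := leqP m N.
    by rewrite (big_cat_nat (leq0n m) mN) /= lerD2l gB1.
  rewrite [leRHS](_ : _ = \sum_(0 <= n < N) `|u n| + (\sum_(N <= n < m) `|u n| + (1 + B))).
    rewrite lerDl addr_ge0 ?sumr_ge0 //; apply: le_trans (gB1 0%N); exact: g0.
  by rewrite (big_cat_nat (leq0n N) (ltnW Nm)) /= !addrA.
have -> : esup_series u = limn S.
  rewrite /esup_series -/S is_cvg_limn_esupE.
    by rewrite EFin_lim.
  by apply/cvg_ex; exists (limn S)%:E; apply: cvg_EFin => //; exact: nearW.
rewrite lee_fin -/(S m).
have h : (S N - S m) ^+ 2 @[N --> \oo] --> (limn S - S m) ^+ 2.
  by rewrite expr2; apply: cvgM; apply: cvgB => //; exact: cvg_cst.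
rewrite -(cvg_lim _ h) //; apply: limr_le; first by apply/cvg_ex; eexists; exact: h.
near=> N.
have mN : (m <= N)%N by near: N; exact: nbhs_infty_ge.
apply: le_trans (gB N); rewrite /S (big_cat_nat (leq0n m) mN) /= addrAC subrr add0r.
by rewrite -[leLHS]real_normK ?num_real // lerXn2r ?nnegrE //; exact: ler_norm_sum.
Unshelve. all: by end_near. Qed.

Context d (T : measurableType d) (mu : {measure set T -> \bar R}).

Lemma Lnorm2_le (f : T -> R) (t : R) : 0 <= t ->
  ('N[mu]_(2%:E)[EFin \o f] <= t%:E)%E <->
  (\int[mu]_x (f x ^+ 2)%:E <= (t ^+ 2)%:E)%E.
Proof.
move=> t0.
have e : ('N[mu]_(2%:E)[EFin \o f] `^ 2 = \int[mu]_x (f x ^+ 2)%:E)%E.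
  rewrite poweR_Lnorm //; apply: eq_integral => x _ /=.
  by rewrite powR_mulrn // real_normK ?num_real.
have e2 : (t ^+ 2)%:E = ((t%:E) `^ 2)%E by rewrite poweR_EFin powR_mulrn.
have N0 := Lnorm_ge0 mu 2%:E (EFin \o f).
rewrite e2 -e; move: N0; set N := Lnorm _ _ _ => N0.
have mono (q : R) (x y : \bar R) : 0 <= q -> (0 <= x -> 0 <= y -> x <= y -> x `^ q <= y `^ q)%E.
  by move=> q0 x0 y0 xy; apply: gt0_ler_poweR => //; rewrite in_itv/= leey andbT.
split => h; first exact: mono.
have := mono 2^-1 _ _ _ _ _ h; rewrite -!poweRrM mulfV // !poweRe1 ?lee_fin //.
by apply; rewrite ?poweR_ge0 ?powR_ge0 ?invr_ge0.
Qed.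

Lemma Lnorm2_sum_le (I : Type) (s : seq I) (f : I -> T -> R) (w : I -> R) :
  (forall i, measurable_fun setT (f i)) ->
  (forall i, 'N[mu]_(2%:E)[EFin \o f i] <= (w i)%:E)%E ->
  ('N[mu]_(2%:E)[EFin \o (fun x => \sum_(i <- s) f i x)%R]
   <= (\sum_(i <- s) w i)%:E)%E.
Proof.
move=> mf fw; elim: s => [|i s IH].
  rewrite big_nil [X in Lnorm _ _ X](_ : _ = cst 0%E) ?Lnorm0 //.
  by apply/funext => x /=; rewrite big_nil.
rewrite big_cons [X in Lnorm _ _ X](_ : _ =
    EFin \o (f i \+ (fun x => \sum_(j <- s) f j x))%R).
  have ms := measurable_sum s mf.
  apply: le_trans (minkowski_EFin mu (mf i) ms _) _; first by rewrite ler1n.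
  by rewrite [leRHS]EFinD; apply: leeD; [exact: fw|exact: IH].
by apply/funext => x /=; rewrite big_cons.
Qed.

(* No almost-everywhere argument is needed: where the series of absolute values
   diverges, the bound on the remainder is infinite. *)
Lemma L2_abs_series (f : nat -> T -> R) (w : nat -> R) :
  (forall n, measurable_fun setT (f n)) ->
  (forall n, 'N[mu]_(2%:E)[EFin \o f n] <= (w n)%:E)%E ->
  measurable_fun setT (fun x => esup_series (f ^~ x)) /\
  forall m (t : R), 0 <= t -> (forall N, \sum_(m <= n < N) w n <= t) ->
    ('N[mu]_(2%:E)[EFin \o
       (fun x => esup_series (f ^~ x) - \sum_(0 <= n < m) f n x)%R] <= t%:E)%E.
Proof.
move=> mf fw.
have mh : measurable_fun setT (fun x => esup_series (f ^~ x)).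
  pose S N x : \bar R := (\sum_(0 <= n < N) f n x)%:E.
  rewrite (_ : (fun x => _) = fine \o (fun x => limn_esup (S ^~ x))) //.
  have mS : measurable_fun setT (fun x => limn_esup (S ^~ x)).
    apply: measurable_realfun.measurable_fun_limn_esup => N.
    by apply/measurable_EFinP; exact: measurable_sum.
  by apply: (measurableT_comp _ mS); apply: measurable_realfun.fine_measurable.
split=> // m t t0 wt; apply/Lnorm2_le => //.
pose g N x := (\sum_(m <= n < N) `|f n x|) ^+ 2.
pose G N x : \bar R := (g N x)%:E.
have mg N : measurable_fun setT (g N).
  by apply: measurable_funX; apply: measurable_sum => n; exact: measurableT_comp.
have gnd x : {homo (G ^~ x) : n m / (n <= m)%N >-> (n <= m)%E}.
  move=> a b ab; rewrite lee_fin lerXn2r ?nnegrE ?sumr_ge0 //.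
  have [ma|am] := leqP m a.
    by rewrite [leRHS](big_cat_nat ma ab) /= lerDl sumr_ge0.
  by rewrite big_geq ?(ltnW am) // sumr_ge0.
have gc x := ereal_nondecreasing_is_cvgn (gnd x).
apply: (@le_trans _ _ (\int[mu]_x limn (G ^~ x))%E).
  apply: ge0_le_integral => //.
  - by move=> x _; rewrite lee_fin sqr_ge0.
  - apply/measurable_EFinP; apply: measurable_funX; apply: measurable_funB => //.
    exact: measurable_sum.
  - apply: (emeasurable_fun_cvg G) => //.
    by move=> N; apply/measurable_EFinP.
  - by move=> x _; exact: (esup_series_tail (f ^~ x)).
rewrite monotone_convergence //; last 2 first.
- by move=> N; apply/measurable_EFinP.
- by move=> N x _; rewrite lee_fin sqr_ge0.
apply: lime_le.
  apply: ereal_nondecreasing_is_cvgn => a b ab; apply: ge0_le_integral => //.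
  - by move=> x _; rewrite lee_fin sqr_ge0.
  - by apply/measurable_EFinP.
  - by apply/measurable_EFinP.
  - by move=> x _; exact: (gnd x).
apply: nearW => N.
apply/(@Lnorm2_le (fun x => \sum_(m <= n < N) `|f n x|) t t0).
apply: le_trans (@Lnorm2_sum_le _ (index_iota m N) (fun n x => `|f n x|) w _ _) _.
- by move=> i; exact: measurableT_comp.
- move=> i; rewrite [X in Lnorm _ _ X](_ : _ = abse \o (EFin \o f i)) // Lnorm_abse.
  exact: fw.
- by rewrite lee_fin.
Qed.

End AbsolutelyConvergentL2.

(** * Tensor products of polynomials on the square *)

Section SquareL2.
Variable R : realType.
Implicit Types (p q : {poly R}) (f g : R * R -> R).

Notation leb := (@lebesgue_measure R).
Notation I := (`[(-1)%R, 1%R]%classic : set R).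

Lemma measurable_square : measurable (square R : set (measurableTypeR R * measurableTypeR R)).
Proof. by apply: measurableX; exact: measurable_itv. Qed.

Definition tens p q (z : R * R) : R := p.[z.1] * q.[z.2].

Lemma tens_restrict p q z :
  (tens p q \_ (square R)) z = (horner p \_ I) z.1 * (horner q \_ I) z.2.
Proof.
rewrite /patch; case: ifPn => [|/negP h].
  by rewrite /square inE => -[/= h1 h2]; rewrite !mem_set.
case: ifPn => h1; last by rewrite mul0r.
case: ifPn => h2; last by rewrite mulr0.
by case: h; move: h1 h2; rewrite !inE.
Qed.

Lemma measurable_restrict_horner p : measurable_fun setT (horner p \_ I).
Proof.
apply/(measurable_restrictT _ _).1; first exact: measurable_itv.
apply: measurable_funTS; apply: continuous_measurable_fun.
exact: continuous_horner.
Qed.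

Lemma integrable_restrict_horner p : leb.-integrable setT (EFin \o (horner p \_ I)).
Proof.
rewrite -restrict_EFin; apply/(integrable_mkcond _ _).1; first exact: measurable_itv.
apply: continuous_compact_integrable; first exact: segment_compact.
by apply: continuous_subspaceT; exact: continuous_horner.
Qed.

Lemma integral_restrict_horner p : (\int[leb]_x ((horner p \_ I) x)%:E = (pint p)%:E)%E.
Proof.
rewrite -integral_itv_horner [RHS]integral_mkcond; apply: eq_integral => x _.
by rewrite /patch; case: ifP.
Qed.

Lemma integral_tens_iter p q :
  (\int[leb]_x \int[leb]_y ((horner p \_ I) x * (horner q \_ I) y)%:E
   = (pint p * pint q)%:E)%E.
Proof.
transitivity (\int[leb]_x ((horner p \_ I) x)%:E * (pint q)%:E)%E.
  rewrite -integralZr //; last exact: integrable_restrict_horner.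
  apply: eq_integral => x _; rewrite -integral_restrict_horner -integralZl //.
  exact: integrable_restrict_horner.
by rewrite integral_restrict_horner EFinM.
Qed.

Lemma measurable_tens p q :
  measurable_fun setT (tens p q \_ (square R)
    : measurableTypeR R * measurableTypeR R -> R).
Proof.
rewrite (_ : _ \_ _ = (fun z => (horner p \_ I) z.1 * (horner q \_ I) z.2)).
  apply: measurable_funM.
  - by apply: measurableT_comp => //; exact: measurable_restrict_horner.
  - by apply: measurableT_comp => //; exact: measurable_restrict_horner.
by apply/funext => z; rewrite tens_restrict.
Qed.

Lemma integral_tens_sqr p q :
  (\int[leb2 R]_z ((tens p q \_ (square R)) z ^+ 2)%:E
   = (pint (p * p) * pint (q * q))%:E)%E.
Proof.
rewrite /leb2 fubini_tonelli1 /fubini_F /=; last 2 first.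
- by apply/measurable_EFinP; apply: measurable_funX; exact: measurable_tens.
- by move=> z; rewrite lee_fin sqr_ge0.
rewrite -integral_tens_iter; apply: eq_integral => x _; apply: eq_integral => y _.
rewrite tens_restrict /= /patch; congr EFin.
by case: ifP; case: ifP => *; rewrite ?hornerM ?mulr0 ?mul0r ?expr0n //; ring.
Qed.

Lemma inL2P f : inL2 f <->
  measurable_fun setT (f \_ (square R) : measurableTypeR R * measurableTypeR R -> R)
  /\ (normL2 f < +oo)%E.
Proof.
rewrite /inL2 inE; split.
  by move=> /andP[]; rewrite !inE.
by move=> [h1 h2]; apply/andP; rewrite !inE.
Qed.

Lemma normL2_tens p q :
  normL2 (tens p q) = (Num.sqrt (pint (p * p) * pint (q * q)))%:E.
Proof.
rewrite /normL2 unlock.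
under eq_integral => z _ do rewrite /= powR_mulrn // real_normK ?num_real //.
rewrite integral_tens_sqr poweR_EFin powR12_sqrt //.
by rewrite mulr_ge0 // pint_sqr_ge0.
Qed.

Lemma normL2_tensZ (c : R) p q :
  normL2 (tens (c *: p) q) = (`|c| * Num.sqrt (pint (p * p) * pint (q * q)))%:E.
Proof.
rewrite normL2_tens -[X in pint X * _]scalerAl -[X in _ *: X]scalerAr !pintZ.
by rewrite -!mulrA mulrA -expr2 sqrtrM ?sqr_ge0 // sqrtr_sqr.
Qed.

Lemma inL2_tens p q : inL2 (tens p q).
Proof. by apply/inL2P; split; [exact: measurable_tens|rewrite normL2_tens ltry]. Qed.

Lemma integral_tens p q : \int[leb2 R]_(z in square R) tens p q z = pint p * pint q.
Proof.
have i1 : (leb2 R).-integrable setT (EFin \o (tens p q \_ (square R))).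
  apply: (proj1 (Lfun1_integrable (leb2 R) (tens p q \_ (square R)))).
  (* Integrability comes from square integrability: multiply by the constant 1, itself a tensor
     product in L_2 of the square. *)
  have := Lfun2_mul_Lfun1 (inL2_tens p q) (inL2_tens 1%:P 1%:P).
  rewrite (_ : _ \* _ = tens p q \_ (square R)) //; apply/funext => z /=.
  by rewrite /patch; case: ifP; rewrite ?mulr0 // /tens !hornerC !mulr1.
rewrite /Rintegral integral_mkcond restrict_EFin.
rewrite -integral12_prod_meas1 // /fubini_F.
rewrite -[RHS]/(fine (_%:E)) -integral_tens_iter; congr fine.
apply: eq_integral => x _; apply: eq_integral => y _ /=.
by rewrite tens_restrict.
Qed.

Lemma legendre2E r i : @legendre2 R r i = tens (legendre R i.1)^`(r) (legendre R i.2)^`(r).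
Proof. by []. Qed.

Lemma coef_tens p q i :
  coef (tens p q) i = pint (p * legendre R i.1) * pint (q * legendre R i.2).
Proof.
rewrite -integral_tens; apply: eq_Rintegral => z _.
by rewrite legendre2E /tens !derivn0 !hornerM; ring.
Qed.

End SquareL2.

(** * Unordered sums in L_2 *)

Section UnorderedSeries.
Variable R : realType.

Lemma bounded_series_small_tail (w : nat -> R) (K : R) :
  (forall n, 0 <= w n) -> (forall N, \sum_(0 <= n < N) w n <= K) ->
  forall e : R, 0 < e -> exists m, forall k N, (m <= k)%N -> \sum_(k <= n < N) w n <= e.
Proof.
move=> w0 wK e e0.
have nd : nondecreasing_seq (series w).
  by apply: nondecreasing_series => n _ _; exact: w0.
have cw : cvgn (series w).
  by apply: nondecreasing_is_cvgn => //; exists K => _ [N _ <-]; exact: wK.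
have : \forall m \near \oo, `|limn (series w) - series w m| < e by exact: cvgr_dist_lt.
move=> [m _ hm]; exists m => k N mk.
have [kN|Nk] := leqP k N; last by rewrite big_geq ?(ltnW Nk) // ltW.
have h1 : series w N <= limn (series w) by exact: nondecreasing_cvgn_le.
have := hm k mk; rewrite /= ltr_norml => /andP[_ h2].
have h3 : series w N = series w k + \sum_(k <= n < N) w n.
  by rewrite /series /= (big_cat_nat (leq0n k) kN).
lra.
Qed.

Lemma big_pmap_oapp (J K : Type) (g : J -> option K) (F : K -> R) (s : seq J) :
  \sum_(i <- pmap g s) F i = \sum_(j <- s) oapp F 0 (g j).
Proof.
elim: s => [|j s IH]; first by rewrite !big_nil.
by rewrite big_cons /=; case: (g j) => [k|] /=; rewrite ?big_cons IH // add0r.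
Qed.

Context d (T : measurableType d) (mu : {measure set T -> \bar R}) (J : countType).

(** Enumerate [J] by its codes, with the term 0 at numbers that code nothing. An arbitrary finite
    [A] is completed to an initial segment of the enumeration by a disjoint [B]; the hypothesis on
    [A] bounds the weight of [B], and the rest of the enumeration weighs at most any prescribed e >
    0. *)
Lemma L2_unordered_series (f : J -> T -> R) (W : J -> R) (K : R) :
  (forall i, measurable_fun setT (f i)) ->
  (forall i, 'N[mu]_(2%:E)[EFin \o f i] <= (W i)%:E)%E ->
  (forall s, uniq s -> \sum_(i <- s) W i <= K) ->
  exists h : T -> R, measurable_fun setT h /\
    forall (A : seq J) (t : R), uniq A -> 0 <= t ->
      (forall s, uniq s -> {in s, forall i, i \notin A} -> \sum_(i <- s) W i <= t) ->
      ('N[mu]_(2%:E)[EFin \o (fun x => h x - \sum_(i <- A) f i x)%R] <= t%:E)%E.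
Proof.
move=> mf fW WK.
pose ff (n : nat) : T -> R := oapp f (fun _ => 0) (pickle_inv n).
pose w (n : nat) : R := oapp W 0 (pickle_inv n).
have mff n : measurable_fun setT (ff n).
  by rewrite /ff; case: pickle_inv => [i|] /=; [exact: mf|exact: measurable_cst].
have ffw n : ('N[mu]_(2%:E)[EFin \o ff n] <= (w n)%:E)%E.
  rewrite /ff /w; case: pickle_inv => [i|] /=; first exact: fW.
  by rewrite [X in Lnorm _ _ X](_ : _ = cst 0%E) ?Lnorm0.
have w0 n : 0 <= w n by rewrite -lee_fin (le_trans (Lnorm_ge0 _ _ _) (ffw n)).
have upm s : uniq s -> uniq (pmap (@pickle_inv J) s).
  exact/pmap_uniq/pickle_invK.
have wK N : \sum_(0 <= n < N) w n <= K.
  by rewrite -big_pmap_oapp WK // upm // iota_uniq.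
have tl := bounded_series_small_tail w0 wK.
have [mh hh] := L2_abs_series mff ffw.
set h := (fun x => esup_series (ff ^~ x)) in mh hh.
exists h; split=> // A t uA t0 At.
apply/lee_addgt0Pr => e e0.
have [m0 hm0] := tl e e0.
pose m := maxn m0 (\max_(i <- A) (@choice.pickle J i).+1).
have mA i : i \in A -> (@choice.pickle J i < m)%N.
  move=> iA; rewrite leq_max; apply/orP; right.
  by rewrite (big_rem i iA) /= leq_maxl.
pose B := [seq i <- pmap (@pickle_inv J) (index_iota 0 m) | i \notin A].
have sumE (F : J -> R) : \sum_(0 <= n < m) oapp F 0 (pickle_inv n)
     = \sum_(i <- A) F i + \sum_(i <- B) F i.
  rewrite -big_pmap_oapp -big_cat; apply: perm_big.
  apply: uniq_perm.
  - by rewrite upm // iota_uniq.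
  - rewrite cat_uniq uA /= filter_uniq ?upm ?iota_uniq // andbT.
    by apply/hasPn => i; rewrite mem_filter => /andP[].
  - move=> i; rewrite mem_cat mem_filter mem_pmap.
    have [iA|_] := boolP (i \in A); rewrite //=.
    by apply/mapP; exists (@choice.pickle J i); rewrite ?mem_iota ?pickleK_inv //= add0n subn0 mA.
have e1 : (fun x => h x - \sum_(i <- A) f i x) =
   (fun x => h x - \sum_(0 <= n < m) ff n x) \+ (fun x => \sum_(i <- B) f i x).
  apply/funext => x /=.
  have e2 : \sum_(0 <= n < m) ff n x = \sum_(0 <= n < m) oapp (f ^~ x) 0 (pickle_inv n).
    by apply: eq_bigr => n _; rewrite /ff; case: pickle_inv.
  by rewrite e2 sumE; ring.
rewrite e1.
have m1 : measurable_fun setT (fun x => h x - \sum_(0 <= n < m) ff n x).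
  by apply: measurable_funB => //; exact: measurable_sum.
have m2 : measurable_fun setT (fun x => \sum_(i <- B) f i x) by exact: measurable_sum.
apply: le_trans (minkowski_EFin mu m1 m2 _) _; first by rewrite ler1n.
rewrite addeC; apply: leeD; last first.
  apply: hh; first exact: ltW.
  by move=> N; apply: hm0; rewrite leq_maxl.
apply: le_trans (Lnorm2_sum_le _ mf fW) _; rewrite lee_fin; apply: At.
  by rewrite filter_uniq ?upm ?iota_uniq.
by move=> i; rewrite mem_filter => /andP[].
Qed.

End UnorderedSeries.

(** * Smoothness classes and mixed derivatives *)

Section SequenceNorms.
Variables (R : realType) (J : choiceType).
Implicit Types (a : J -> R) (t : seq J).

Lemma sum_le_esum a t : (forall i, 0 <= a i) -> uniq t ->
  ((\sum_(i <- t) a i)%:E <= \esum_(i in [set: J]) (a i)%:E)%E.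
Proof.
move=> a0 ut; apply: esum_ge; exists [set` t].
  by split => //; exact: finite_seq.
by rewrite -fsbig_seq // sumEFin.
Qed.

Lemma esum_le a (K : R) : (forall t, uniq t -> \sum_(i <- t) a i <= K) ->
  (\esum_(i in [set: J]) (a i)%:E <= K%:E)%E.
Proof.
move=> aK; apply: ge_ereal_sup => _ [A [fA _] <-].
have -> : A = [set` fset_set A] by rewrite fset_setK.
by rewrite -fsbig_seq ?fset_uniq // sumEFin lee_fin aK ?fset_uniq.
Qed.

Lemma le_poweR (q : R) (x y : \bar R) : 0 <= q -> (0 <= x -> x <= y -> x `^ q <= y `^ q)%E.
Proof.
move=> q0 x0 xy; apply: gt0_ler_poweR => //; rewrite in_itv/= leey andbT //.
exact: le_trans xy.
Qed.

(** This passes between the norms on sequences and sums over duplicate-free lists, on which all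
    later estimates are made. *)
Lemma esum_poweR_le a (q K : R) : 0 < q -> 0 <= K -> (forall i, 0 <= a i) ->
  ((\esum_(i in [set: J]) (a i)%:E) `^ q^-1 <= K%:E)%E <->
  (forall t, uniq t -> \sum_(i <- t) a i <= K `^ q).
Proof.
move=> q0 K0 a0; split => [h t ut|h].
  rewrite -lee_fin; apply: le_trans (sum_le_esum a0 ut) _.
  have e0 : (0 <= \esum_(i in [set: J]) (a i)%:E)%E.
    by apply: esum_ge0 => i _; rewrite lee_fin.
  have := le_poweR (ltW q0) _ h; rewrite -poweRrM mulVf ?gt_eqF // poweRe1 //.
  by rewrite poweR_EFin; apply; exact: poweR_ge0.
have e0 : (0 <= \esum_(i in [set: J]) (a i)%:E)%E.
  by apply: esum_ge0 => i _; rewrite lee_fin.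
apply: le_trans (le_poweR (q := q^-1) _ e0 (esum_le h)) _.
  by rewrite invr_ge0 ltW.
by rewrite poweR_EFin -powRrM mulfV ?gt_eqF // powRr1.
Qed.

End SequenceNorms.

Section Classes.
Variable R : realType.

Lemma smooth_norm_le1 (s mu : R) (f : R * R -> R) : 1 <= s ->
  (smooth_norm s mu f <= 1)%E <->
  (forall t : seq (nat * nat), uniq t ->
    \sum_(i <- t) ((maxn 1 (i.1 * i.2))%:R `^ (s * mu)) * `|coef f i| `^ s <= 1).
Proof.
move=> s1; have s0 : 0 < s by rewrite (lt_le_trans _ s1).
rewrite -[X in _ <-> X](_ : (forall t : seq (nat * nat), uniq t ->
    \sum_(i <- t) ((maxn 1 (i.1 * i.2))%:R `^ (s * mu)) * `|coef f i| `^ s <= 1 `^ s) = _).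
  by apply: esum_poweR_le => // i; rewrite mulr_ge0 ?powR_ge0.
by rewrite powR1.
Qed.

Lemma admissible_fin (p delta : R) f x : 1 <= p -> 0 <= delta ->
  admissible p%:E delta f x ->
  forall t : seq (nat * nat), uniq t -> \sum_(i <- t) `|coef f i - x i| `^ p <= delta `^ p.
Proof.
move=> p1 d0; have p0 : 0 < p by rewrite (lt_le_trans _ p1).
by move=> /esum_poweR_le; apply => // i; rewrite powR_ge0.
Qed.

Lemma admissible_pinfty (delta : R) f x : admissible +oo%E delta f x ->
  forall i, `|coef f i - x i| <= delta.
Proof.
move=> h i; rewrite -lee_fin; apply: le_trans h.
by apply: ereal_sup_ubound; exists i.
Qed.

Lemma admissible_exact (p : \bar R) (delta : R) f x : (1 <= p)%E -> 0 <= delta ->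
  (forall i, x i = coef f i) -> admissible p delta f x.
Proof.
move=> p1 d0 xE; rewrite /admissible /lp_norm; case: p p1 => [p| |] //= p1.
  move: p1; rewrite lee_fin => p1.
  apply/esum_poweR_le => //; first by rewrite (lt_le_trans _ p1).
  move=> t _; rewrite big1 ?powR_ge0 // => i _.
  by rewrite xE subrr normr0 powR0 // gt_eqF // (lt_le_trans _ p1).
by apply: ge_ereal_sup => _ [i _ <-]; rewrite xE subrr normr0 lee_fin.
Qed.

End Classes.

Section MixedDerivative.
Variables (R : realType) (r : nat).
Implicit Types (f g h : R * R -> R) (i : nat * nat).

Notation T := (measurableTypeR R * measurableTypeR R)%type.
Notation meas f := (measurable_fun setT (f \_ (square R) : T -> R)).

Lemma restrictD f g : (fun z => f z + g z) \_ (square R) = (f \_ (square R) \+ g \_ (square R)).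
Proof. by apply/funext => z /=; rewrite /patch; case: ifP; rewrite ?addr0. Qed.

Lemma restrictN f : (fun z => - f z) \_ (square R) = (fun z => - (f \_ (square R)) z).
Proof. by apply/funext => z /=; rewrite /patch; case: ifP; rewrite ?oppr0. Qed.

Lemma normL2D f g : meas f -> meas g ->
  (normL2 (fun z => f z + g z)%R <= normL2 f + normL2 g)%E.
Proof.
by move=> mf mg; rewrite /normL2 restrictD; apply: minkowski_EFin => //; rewrite ler1n.
Qed.

Lemma normL2N f : normL2 (fun z => - f z) = normL2 f.
Proof.
rewrite /normL2 restrictN -[RHS]oppe_Lnorm; congr Lnorm.
Qed.

Lemma measD f g : meas f -> meas g -> meas (fun z => f z + g z).
Proof. by move=> mf mg; rewrite restrictD; exact: measurable_funD. Qed.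

Lemma measN f : meas f -> meas (fun z => - f z).
Proof. by move=> mf; rewrite restrictN; exact: measurableT_comp. Qed.

Lemma scale_legendre2 (c : R) i : (fun z => c * legendre2 r i z)
  = tens (c *: (legendre R i.1)^`(r)) (legendre R i.2)^`(r).
Proof. by apply/funext => z; rewrite /tens hornerZ mulrA. Qed.

Lemma meas_legendre2 (c : R) i : meas (fun z => c * legendre2 r i z).
Proof.
rewrite scale_legendre2.
exact: measurable_tens.
Qed.

(** This is the L_2-norm of [legendre2 r i] itself, not its square. *)
Definition dlegendre_norm2 i : R :=
  Num.sqrt (pint ((legendre R i.1)^`(r) * (legendre R i.1)^`(r)) *
     pint ((legendre R i.2)^`(r) * (legendre R i.2)^`(r))).

Lemma normL2_legendre2 (c w : R) i :
  dlegendre_norm2 i <= w ->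
  (normL2 (fun z => c * legendre2 r i z)%R <= (`|c| * w)%:E)%E.
Proof.
by move=> hw; rewrite scale_legendre2 normL2_tensZ lee_fin ler_wpM2l.
Qed.

Lemma normL2_sum (s : seq (nat * nat)) (c w : nat * nat -> R) :
  (forall i, i \in s -> dlegendre_norm2 i <= w i) ->
  meas (fun z => \sum_(i <- s) c i * legendre2 r i z) /\
  (normL2 (fun z => (\sum_(i <- s) c i * legendre2 r i z)%R)
    <= (\sum_(i <- s) `|c i| * w i)%:E)%E.
Proof.
elim: s => [|i s IH] hs.
  have -> : (fun z => \sum_(i <- [::]) c i * legendre2 r i z) = (fun z => 0 * legendre2 r (0, 0)%N z).
    by apply/funext => z; rewrite big_nil mul0r.
  split; first exact: meas_legendre2.
  apply: le_trans (normL2_legendre2 _ (lexx _)) _.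
  by rewrite big_nil normr0 mul0r.
have [m1 n1] := IH (fun j js => hs j (mem_behead (s := i :: s) js)).
have m2 := meas_legendre2 (c i) i.
have -> : (fun z => \sum_(j <- i :: s) c j * legendre2 r j z) =
  (fun z => c i * legendre2 r i z + \sum_(j <- s) c j * legendre2 r j z).
  by apply/funext => z; rewrite big_cons.
split; first exact: measD.
apply: le_trans (normL2D m2 m1) _; rewrite big_cons EFinD; apply: leeD => //.
by apply: normL2_legendre2; apply: hs; rewrite mem_head.
Qed.

End MixedDerivative.

(** Take [s0] with a sum within e of the supremum: appending a disjoint list cannot exceed the
    supremum. *)
Lemma bounded_sums_small_tail (R : realType) (J : eqType) (W : J -> R) (K : R) :
  (forall s, uniq s -> \sum_(i <- s) W i <= K) ->
  forall e, 0 < e -> exists2 s0, uniq s0 &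
    forall s, uniq s -> {in s, forall i, i \notin s0} -> \sum_(i <- s) W i <= e.
Proof.
move=> WK e e0.
pose S := [set x | exists2 s, uniq s & x = \sum_(i <- s) W i].
have hS : has_sup S.
  split; first by exists 0; exists [::]; rewrite ?big_nil.
  by exists K => _ [s us ->]; exact: WK.
have [_ [s0 us0 ->] hs0] := sup_adherent e0 hS.
exists s0 => // s us ss0.
have : \sum_(i <- s0 ++ s) W i <= sup S.
  apply: sup_upper_bound => //; exists (s0 ++ s) => //.
  by rewrite cat_uniq us0 us andbT; apply/hasPn => i /ss0.
by rewrite big_cat /=; lra.
Qed.

Section MixedDerivativeDistance.
Variables (R : realType) (r : nat).
Implicit Types (f g h : R * R -> R) (i : nat * nat).

Notation T := (measurableTypeR R * measurableTypeR R)%type.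
Notation meas f := (measurable_fun setT (f \_ (square R) : T -> R)).
Notation deg_ge i := ((r <= i.1)%N && (r <= i.2)%N).

Lemma meas_restrict (g : T -> R) : measurable_fun setT g -> meas g.
Proof.
move=> mg; apply/(measurable_restrictT _ _).1; first exact: measurable_square.
exact: measurable_funTS.
Qed.

Lemma Lnorm_restrict_le (g : T -> R) (t : R) : 0 <= t -> measurable_fun setT g ->
  ('N[leb2 R]_(2%:E)[EFin \o g] <= t%:E)%E -> (normL2 g <= t%:E)%E.
Proof.
move=> t0 mg /(Lnorm2_le _ _ t0) h; apply/(Lnorm2_le _ _ t0).
apply: le_trans h; apply: ge0_le_integral => //.
- by move=> z _; rewrite lee_fin sqr_ge0.
- apply/measurable_EFinP; apply: measurable_funX.
  exact: meas_restrict.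
- by apply/measurable_EFinP; apply: measurable_funX.
- move=> z _; rewrite lee_fin /patch; case: ifP => // _.
  by rewrite expr0n sqr_ge0.
Qed.

(** The bound [K] guarantees that the series of the mixed derivative converges, since otherwise the
    distance would be +oo. Then [t] measures the terms outside [H], and [u] the errors of the
    coefficients inside. *)
Lemma mixed_deriv_dist_le f (c w : nat * nat -> R) (K t u : R) (H : {fset nat * nat}) :
  (forall i, deg_ge i -> dlegendre_norm2 R r i <= w i) ->
  (forall i, i \in H -> deg_ge i) -> 0 <= t ->
  (forall s, uniq s -> {in s, forall i, deg_ge i} -> \sum_(i <- s) `|coef f i| * w i <= K) ->
  (forall s, uniq s -> {in s, forall i, deg_ge i && (i \notin H)} ->
     \sum_(i <- s) `|coef f i| * w i <= t) ->
  \sum_(i <- H) `|coef f i - c i| * w i <= u ->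
  (mixed_deriv_dist r f (fun z => \sum_(i <- H) c i * legendre2 r i z)%R <= (t + u)%:E)%E.
Proof.
move=> hw HQ t0 hK ht hu.
(* Zero coefficients outside the range k, j >= r let the series run over the whole countable type of
   pairs. *)
pose c' i := if deg_ge i then coef f i else 0.
pose W i := if deg_ge i then `|coef f i| * w i else 0.
(* Terms are cut off to the square because the convergence theorem is applied on the whole plane. *)
pose F i : T -> R := (fun z => c' i * legendre2 r i z) \_ (square R).
have mF i : measurable_fun setT (F i) by exact: meas_legendre2.
have FW i : ('N[leb2 R]_(2%:E)[EFin \o F i] <= (W i)%:E)%E.
  rewrite /F /W /c'; case: ifPn => hi; first by apply: normL2_legendre2; exact: hw.
  apply: le_trans (normL2_legendre2 _ (lexx _)) _.
  by rewrite normr0 mul0r.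
have sumW s : uniq s -> \sum_(i <- s) W i = \sum_(i <- [seq i <- s | deg_ge i]) `|coef f i| * w i.
  by move=> us; rewrite big_filter [RHS]big_mkcond.
have WK s : uniq s -> \sum_(i <- s) W i <= K.
  move=> us; rewrite sumW // hK ?filter_uniq // => i.
  by rewrite mem_filter => /andP[].
have [h [mh hh]] := L2_unordered_series mF FW WK.
have normh (A : {fset nat * nat}) (e : R) : 0 <= e ->
    (forall s, uniq s -> {in s, forall i, i \notin A} -> \sum_(i <- s) W i <= e) ->
    (normL2 (fun z => h z - \sum_(i <- A) c' i * legendre2 r i z)%R <= e%:E)%E.
  move=> e0 he.
  have := hh A e (fset_uniq A) e0 he => hA.
  have mA : measurable_fun setT (fun x => h x - \sum_(i <- A) F i x).
    by apply: measurable_funB => //; exact: measurable_sum.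
  have := Lnorm_restrict_le e0 mA hA.
  rewrite /normL2; congr (Lnorm _ _ _ <= _)%E; congr (_ \o _).
  apply/funext => z; rewrite /patch; case: ifPn => // zs.
  congr (_ - _); apply: eq_bigr => i _; rewrite /F /patch zs //.
have sumc' (A : {fset nat * nat}) z : \sum_(i <- A) c' i * legendre2 r i z =
    \sum_(i <- A | deg_ge i) coef f i * legendre2 r i z.
  rewrite [RHS]big_mkcond; apply: eq_bigr => i _.
  by rewrite /c'; case: ifP => // _; rewrite mul0r.
have hder : is_mixed_deriv r f h.
  split.
    apply/inL2P; split; first exact: meas_restrict.
    have K0 : 0 <= K by have := WK [::] isT; rewrite big_nil.
    apply: le_lt_trans (ltry K).
    have := normh fset0 K K0 (fun s us _ => WK s us).
    by under eq_fun do rewrite big_seq_fset0 subr0.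
  move=> e e0; have [s0 us0 hs0] := bounded_sums_small_tail WK e0.
  exists [fset i in s0]%fset => A sA.
  have hA : forall s, uniq s -> {in s, forall i, i \notin A} -> \sum_(i <- s) W i <= e.
    move=> s us hs; apply: hs0 => // i /hs; apply: contraNN => is0.
    by apply: (fsubsetP sA); rewrite inE.
  have := normh A e (ltW e0) hA.
  by under eq_fun do rewrite sumc'.
apply: (@le_trans _ _ (normL2 (fun z => h z - \sum_(i <- H) c i * legendre2 r i z)%R)).
  by apply: ereal_inf_lbound; exists h.
pose g z := h z - \sum_(i <- H) c' i * legendre2 r i z.
pose k z := \sum_(i <- H) (coef f i - c i) * legendre2 r i z.
have -> : (fun z => h z - \sum_(i <- H) c i * legendre2 r i z) = (fun z => g z + k z).
  apply/funext => z; rewrite /g /k sumc'.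
  have -> : \sum_(i <- H | deg_ge i) coef f i * legendre2 r i z
    = \sum_(i <- H) coef f i * legendre2 r i z.
    rewrite big_mkcond; apply: eq_big_seq => i iH.
    by rewrite HQ.
  have -> : \sum_(i <- H) (coef f i - c i) * legendre2 r i z =
      \sum_(i <- H) coef f i * legendre2 r i z - \sum_(i <- H) c i * legendre2 r i z.
    by rewrite -sumrB; apply: eq_bigr => i _; rewrite mulrBl.
  by ring.
have [mk nk] := @normL2_sum R r H (fun i => coef f i - c i) w (fun i iH => hw i (HQ i iH)).
have mg : meas g.
  apply: measD; first exact: meas_restrict.
  apply: measN.
  by have [] := @normL2_sum R r H c' _ (fun i _ => lexx _).
apply: le_trans (normL2D mg mk) _; rewrite EFinD; apply: leeD.
  apply: normh => // s us sH; rewrite sumW // ht ?filter_uniq // => i.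
  by rewrite mem_filter => /andP[-> /sH].
by apply: le_trans nk _; rewrite lee_fin.
Qed.

End MixedDerivativeDistance.

(** * Functions with vanishing Galerkin data *)

Section FoolingFunction.
Variables (R : realType) (r : nat).
Implicit Types (f g h v : R * R -> R) (i : nat * nat) (a : R).

Notation T := (measurableTypeR R * measurableTypeR R)%type.
Notation meas f := (measurable_fun setT (f \_ (square R) : T -> R)).

(** The distance is an infimum over all sums [h] of the series, so each of them has to be compared
    with [g]. Every partial sum over an index set containing [B] equals [g], hence [h - g] has norm
    0. *)
Lemma mixed_deriv_dist_ge f g v (B : {fset nat * nat}) :
  (forall i, i \notin B -> coef f i = 0) ->
  (forall i, i \in B -> (r <= i.1)%N && (r <= i.2)%N) ->
  g = (fun z => \sum_(i <- B) coef f i * legendre2 r i z) ->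
  inL2 v -> (normL2 (fun z => g z - v z)%R <= mixed_deriv_dist r f v)%E.
Proof.
move=> fB hB gE /inL2P[mv _]; apply: le_ereal_inf_tmp => _ [h [/inL2P[mh _] hh] <-].
have mg : meas g by rewrite gE; have [] := @normL2_sum R r B (coef f) _ (fun i _ => lexx _).
have hg : (normL2 (fun z => h z - g z)%R <= 0)%E.
  apply/lee_addgt0Pr => e e0; rewrite add0e.
  have [A0 hA] := hh e e0; have := hA (A0 `|` B)%fset (fsubsetUl _ _).
  congr (normL2 _ <= _)%E; apply/funext => z; congr (_ - _); rewrite gE.
  rewrite (bigID (mem B)) /= [X in _ + X]big1 ?addr0; last first.
    by move=> i /andP[_ /fB ->]; rewrite mul0r.
  rewrite -big_filter; apply: perm_big; apply: uniq_perm; rewrite ?filter_uniq ?fset_uniq //.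
  move=> i; rewrite mem_filter !inE.
  by have [/hB ->|] := boolP (i \in B); rewrite ?orbT ?andbF.
have -> : (fun z => g z - v z) = (fun z => (h z - v z) + (- (h z - g z))).
  by apply/funext => z; ring.
have m1 : meas (fun z => h z - v z) by apply: measD => //; exact: measN.
have m2 : meas (fun z => - (h z - g z)) by apply: measN; apply: measD => //; exact: measN.
apply: le_trans (normL2D m1 m2) _; rewrite normL2N -[leRHS]adde0.
exact: leeD.
Qed.

Variables (s : seq nat) (us : uniq s) (hs : {in s, forall k, (r <= k)%N}).

(** The second index is frozen at r, the least one allowed, so that the growth comes from a
    polynomial in one variable. *)
Definition fooling a : R * R -> R := tens (a *: \sum_(k <- s) legendre R k) (legendre R r).

Lemma coef_fooling a i :
  coef (fooling a) i = if (i.1 \in s) && (i.2 == r) then a else 0.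
Proof.
rewrite coef_tens -scalerAl pintZ mulr_suml pint_sum.
have -> : \sum_(k <- s) pint (legendre R k * legendre R i.1) = (i.1 \in s)%:R.
  have [h|h] := boolP (i.1 \in s).
    rewrite (bigD1_seq i.1) //= legendre_norm big1 ?addr0 // => k.
    exact: pint_legendre_neq.
  rewrite big1_seq // => k /andP[_ ks]; apply: pint_legendre_neq.
  by apply: contraNneq h => <-.
have [->|ne] := eqVneq i.2 r.
  by rewrite legendre_norm mulr1 andbT; case: (_ \in _); rewrite ?mulr1 ?mulr0.
by rewrite pint_legendre_neq ?mulr0 ?andbF // eq_sym.
Qed.

Definition fooling_norm : R :=
  Num.sqrt (pint ((\sum_(k <- s) legendre R k)^`(r) * (\sum_(k <- s) legendre R k)^`(r))
    * pint ((legendre R r)^`(r) * (legendre R r)^`(r))).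

Lemma mixed_deriv_dist_fooling a v : inL2 v ->
  (normL2 (fun z => tens (a *: (\sum_(k <- s) legendre R k)^`(r)) (legendre R r)^`(r) z - v z)%R
    <= mixed_deriv_dist r (fooling a) v)%E.
Proof.
move=> v2; pose B := [fset i in [seq (k, r) | k <- s]]%fset.
have BE i : (i \in B) = (i.1 \in s) && (i.2 == r).
  rewrite /B inE; apply/mapP/andP => [[k ks ->] //=|].
  by case: i => k j /= [ks /eqP ->]; exists k.
apply: (@mixed_deriv_dist_ge _ _ _ B) => //.
- by move=> i; rewrite BE coef_fooling => /negPf ->.
- by move=> i; rewrite BE => /andP[/hs -> /eqP ->] /=.
apply/funext => z.
have uB : uniq [seq (k, r) | k <- s] by rewrite map_inj_uniq // => ? ? [].
have -> : \sum_(i <- B) coef (fooling a) i * legendre2 r i z =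
   \sum_(i <- [seq (k, r) | k <- s]) coef (fooling a) i * legendre2 r i z.
  by apply: perm_big; apply: uniq_perm => //; move=> i; rewrite /B inE.
rewrite big_map derivn_sum /tens hornerZ horner_sum -mulrA mulr_suml mulr_sumr.
rewrite !big_seq; apply: eq_bigr => k ks.
by rewrite coef_fooling /= ks eqxx /legendre2.
Qed.

(* The functions [fooling a] and [fooling (- a)] both admit the data 0 on
   [Omega], so one of them is reconstructed with error at least half the
   distance of their derivatives. *)
Lemma method_error_fooling (sm mu : R) (p : \bar R) (delta a : R)
    (Omega : {fset nat * nat}) (psi : {ffun Omega -> R} -> R * R -> R) :
  (1 <= p)%E -> 0 <= delta -> 0 <= a -> 1 <= sm ->
  (forall c, inL2 (psi c)) -> (forall k, k \in s -> (k, r) \notin Omega) ->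
  \sum_(k <- s) ((k * r)%:R `^ (sm * mu) * a `^ sm) <= 1 -> (0 < r)%N ->
  ((a * fooling_norm)%:E <= method_error r sm mu p delta psi)%E.
Proof.
move=> p1 d0 a0 sm1 psi2 sO hsum r0.
pose x0 : nat * nat -> R := fun=> 0; set v := psi (galerkin Omega x0).
have err b : `|b| = a ->
    (normL2 (fun z => tens (b *: (\sum_(k <- s) legendre R k)^`(r)) (legendre R r)^`(r) z - v z)%R
    <= method_error r sm mu p delta psi)%E.
  move=> ba; apply: le_trans (mixed_deriv_dist_fooling b (psi2 _)) _.
  (* The data are the exact coefficients, which are admissible for all p and delta; on [Omega] they
     are 0, as they are for the zero sequence [x0]. *)
  apply: ereal_sup_ubound; exists (fooling b), (coef (fooling b)); split.
  - split; first exact: inL2_tens.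
    apply/smooth_norm_le1 => // t ut; apply: le_trans hsum.
    rewrite (bigID (fun i : nat * nat => (i.1 \in s) && (i.2 == r))) /=.
    rewrite [X in _ + X]big1 ?addr0; last first.
      move=> i /negPf h; rewrite coef_fooling h normr0 powR0 ?mulr0 //.
      by rewrite gt_eqF // (lt_le_trans _ sm1).
    rewrite -big_filter.
    have -> : \sum_(k <- s) (k * r)%:R `^ (sm * mu) * a `^ sm =
      \sum_(i <- [seq (k, r) | k <- s]) (maxn 1 (i.1 * i.2))%:R `^ (sm * mu) * `|coef (fooling b) i| `^ sm.
      rewrite big_map !big_seq; apply: eq_bigr => k ks.
      rewrite coef_fooling /= ks eqxx ba; congr (_%:R `^ _ * _).
      by apply/esym/maxn_idPr; rewrite muln_gt0 r0 andbT (leq_trans r0) // hs.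
    rewrite [leRHS](bigID (mem [seq i <- t | (i.1 \in s) && (i.2 == r)])) /=.
    rewrite ler_wpDr //; first by rewrite sumr_ge0 // => i _; rewrite mulr_ge0 ?powR_ge0.
    rewrite -[leRHS]big_filter le_eqVlt; apply/orP; left; apply/eqP/perm_big.
    apply: uniq_perm; rewrite ?filter_uniq //.
      by rewrite map_inj_uniq // => ? ? [].
    move=> i; rewrite !mem_filter.
    have [/= /andP[h1 /eqP h2]|//] := boolP ((i.1 \in s) && (i.2 == r)).
    rewrite (_ : i \in [seq (k, r) | k <- s]) ?andbT //.
    by apply/mapP; exists i.1 => //; rewrite -h2; case: (i).
  - exact: admissible_exact.
  - congr (mixed_deriv_dist _ _ (psi _)); apply/ffunP => i; rewrite !ffunE coef_fooling.
    case: ifP => // /andP[h1 /eqP h2]; have := sO _ h1.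
    by case: i h1 h2 => -[k j] /= io h1 h2; rewrite -h2 io.
have e1 := err a (ger0_norm a0).
have e2 := err (- a) _; rewrite normrN ger0_norm // in e2; have {}e2 := e2 erefl.
set E := method_error _ _ _ _ _ _ in e1 e2 *.
have [mv _] := (inL2P v).1 (psi2 _).
set P := (\sum_(k <- s) legendre R k)^`(r) in e1 e2 *.
have mt b : meas (tens (b *: P) (legendre R r)^`(r)) by exact: measurable_tens.
have e3 : ((2 * (a * fooling_norm))%:E <= E + E)%E.
  apply: le_trans (leeD e1 e2).
  rewrite -[X in (_ + X)%E]normL2N.
  have md b : meas (fun z => tens (b *: P) (legendre R r)^`(r) z - v z).
    by apply: measD => //; exact: measN.
  apply: le_trans (normL2D (md a) (measN (md (- a)))).
  rewrite [X in normL2 X](_ : _ = tens ((2 * a) *: P) (legendre R r)^`(r)).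
    by rewrite normL2_tensZ lee_fin ger0_norm ?mulr_ge0 // mulrA.
  by apply/funext => z; rewrite /tens !hornerZ; ring.
move: e3; clear e1 e2; case: E => [E| |] //=.
- by rewrite !lee_fin; lra.
- by move=> _; rewrite leey.
Qed.

End FoolingFunction.

(** * Lower bound *)

Section LowerBound.
Variables (R : realType) (r : nat).
Hypothesis r0 : (0 < r)%N.

(** The value at 1 is positive, and the end-point inequality bounds its square by a multiple of the
    integral. *)
Lemma dlegendre_top_gt0 : 0 < pint ((legendre R r)^`(r) * (legendre R r)^`(r)).
Proof.
have hs : (size (legendre R r)^`(r) <= r.+1)%N.
  exact: leq_trans (size_derivn_le _ _) (size_legendre R r).
have := horner1_sqr_le hs.
have h1 : 0 < (legendre R r)^`(r).[1].
  rewrite horner_derivn_legendre ?expr1n // mulr1; apply: mulr_gt0.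
    by rewrite sqrtr_gt0 ltr_wpDl // invr_gt0.
  apply: divr_gt0; last by rewrite mulr_gt0 ?exprn_gt0 ?ltr0n ?fact_gt0.
  by rewrite ltr0n muln_gt0 !ffact_gt0 leqnn leq_addr.
move=> h; have h2 : 0 < r.+1%:R ^+ 2 * pint ((legendre R r)^`(r) * (legendre R r)^`(r)).
  by apply: lt_le_trans h; rewrite exprn_gt0.
by move: h2; rewrite pmulr_rgt0 // exprn_gt0.
Qed.

(** At the end point 1 all summands are positive and add up without cancellation. The factor N
    gained from their number cancels the degree factor (3 + r) N lost in [horner1_sqr_le], up to 3 +
    r. *)
Lemma fooling_norm_ge (N : nat) (t : seq nat) : (0 < N)%N -> (N <= size t)%N ->
  {in t, forall k, (N + r <= k < 3 * N + r)%N} ->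
  N%:R `^ (2 * r%:R + 2^-1) / ((3 + r)%:R * (2 ^+ r * r`!%:R))
    * Num.sqrt (pint ((legendre R r)^`(r) * (legendre R r)^`(r))) <= fooling_norm R r t.
Proof.
move=> N0 Nt ht.
rewrite /fooling_norm sqrtrM ?pint_sqr_ge0 // ler_wpM2r ?sqrtr_ge0 //.
set G := (\sum_(k <- t) legendre R k)^`(r).
have Np : 0 < N%:R :> R by rewrite ltr0n.
have sG : (size G <= (3 + r) * N)%N.
  have h1 : (size (\sum_(k <- t) legendre R k)%R <= (3 + r) * N)%N.
    rewrite big_seq; elim/big_ind: _ => [|p q hp hq|k /ht kt]; first by rewrite size_poly0.
      by apply: leq_trans (size_polyD _ _) _; rewrite geq_max hp.
    by apply: leq_trans (size_legendre R k) _; nia.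
  exact: leq_trans (size_derivn_le _ _) h1.
have := horner1_sqr_le sG.
set D := 2 ^+ r * r`!%:R.
have D0 : 0 < D by rewrite mulr_gt0 ?exprn_gt0 ?ltr0n ?fact_gt0.
set v := Num.sqrt N%:R * N%:R ^+ (2 * r) / D.
have v0 : 0 <= v by rewrite divr_ge0 ?mulr_ge0 ?sqrtr_ge0 ?exprn_ge0 // ltW.
have hG : N%:R * v <= G.[1].
  rewrite /G derivn_sum horner_sum.
  have : \sum_(k <- t) v <= \sum_(k <- t) (legendre R k)^`(r).[1].
    rewrite big_seq [leRHS]big_seq; apply: ler_sum => k /ht /andP[hk _].
    exact: horner1_derivn_legendre_ge.
  apply: le_trans; rewrite big_const_seq count_predT iter_addr_0 -[leRHS]mulr_natl.
  by rewrite ler_wpM2r // ler_nat.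
move=> hG2.
have hm : 0 < (3 + r)%:R * N%:R :> R by rewrite mulr_gt0 // ltr0n.
have h3 : G.[1] <= (3 + r)%:R * N%:R * Num.sqrt (pint (G * G)).
  have g0 : 0 <= G.[1] by apply: le_trans hG; rewrite mulr_ge0.
  rewrite -(@ler_pXn2r _ 2) ?nnegrE ?mulr_ge0 ?sqrtr_ge0 //.
  by rewrite exprMn sqr_sqrtr ?pint_sqr_ge0 // -natrM.
have -> : N%:R `^ (2 * r%:R + 2^-1) = Num.sqrt N%:R * N%:R ^+ (2 * r) :> R.
  have -> : N%:R `^ (2 * r%:R + 2^-1) = N%:R `^ (2 * r%:R) * N%:R `^ 2^-1 :> R.
    by rewrite powRD //; apply/implyP => _; rewrite gt_eqF.
  by rewrite powR12_sqrt // mulrC -powR_mulrn // natrM.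
rewrite -(ler_pM2l hm); apply: le_trans (le_trans hG h3).
rewrite le_eqVlt; apply/orP; left; apply/eqP; rewrite /v.
by field; rewrite (gt_eqF D0) // -natrD pnatr_eq0.
Qed.

Lemma galerkin_radius_ge (s mu : R) : 1 <= s -> 0 <= mu ->
  exists c : R, 0 < c /\ forall (p : \bar R) (N : nat) (delta : R),
    (1 <= p)%E -> (0 < N)%N -> 0 <= delta ->
    ((c * N%:R `^ (- mu + 2 * r%:R - s^-1 + 2^-1))%:E
      <= galerkin_radius r s mu p N delta)%E.
Proof.
move=> s1 mu0; have s0 : 0 < s by rewrite (lt_le_trans _ s1).
set Cr := Num.sqrt (pint ((legendre R r)^`(r) * (legendre R r)^`(r))).
have Cr0 : 0 < Cr by rewrite sqrtr_gt0 dlegendre_top_gt0.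
set D := (3 + r)%:R * (2 ^+ r * r`!%:R) : R.
have D0 : 0 < D by rewrite !mulr_gt0 ?exprn_gt0 ?ltr0n ?fact_gt0.
set B := ((3 + r) * r)%:R : R.
have B0 : 0 < B by rewrite ltr0n muln_gt0 r0.
exists (2 `^ (- s^-1) * B `^ (- mu) / D * Cr); split.
  by rewrite !mulr_gt0 ?powR_gt0 ?invr_gt0.
move=> p N delta p1 N0 d0; apply: le_ereal_inf_tmp => _ [Om [psi [hOm cOm psi2 ->]]].
have Np : 0 < N%:R :> R by rewrite ltr0n.
pose t := [seq k <- iota (N + r) (2 * N) | (k, r) \notin Om].
have ut : uniq t by rewrite filter_uniq ?iota_uniq.
have ht : {in t, forall k, (N + r <= k < 3 * N + r)%N}.
  by move=> k; rewrite mem_filter mem_iota addnAC -mulSn => /andP[].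
have tN : (N <= size t)%N.
  have := count_predC (fun k => (k, r) \notin Om) (iota (N + r) (2 * N)).
  rewrite size_iota -!size_filter -/t.
  set u := [seq k <- _ | predC _ k] => h.
  rewrite -(leq_add2r (size u)) h mul2n -addnn leq_add2l.
  apply: leq_trans cOm; rewrite -(size_map (fun k => (k, r))).
  apply: uniq_leq_size.
    by rewrite map_inj_uniq ?filter_uniq ?iota_uniq // => ? ? [].
  move=> _ /mapP[k + ->]; rewrite mem_filter /= negbK => /andP[-> _] //.
have tN2 : (size t <= 2 * N)%N.
  by rewrite size_filter (leq_trans (count_size _ _)) // size_iota.
(* The first factor pays for the at most 2 N summands, the second for their weights, as k r <= (3 +
   r) r N = B N. *)
pose a := (2 * N%:R) `^ (- s^-1) * (B * N%:R) `^ (- mu).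
have a0 : 0 <= a by rewrite mulr_ge0 ?powR_ge0.
have hsum : \sum_(k <- t) ((k * r)%:R `^ (s * mu) * a `^ s) <= 1.
  have as_ : a `^ s = (2 * N%:R)^-1 * (B * N%:R) `^ (- (s * mu)).
    rewrite /a powRM ?powR_ge0 // -!powRrM mulNr mulVf ?gt_eqF // powR_inv1 ?mulr_ge0 //.
    by rewrite mulNr [mu * s]mulrC.
  apply: (@le_trans _ _ (\sum_(k <- t) (2 * N%:R)^-1)).
    rewrite big_seq [leRHS]big_seq; apply: ler_sum => k /ht hk.
    rewrite as_ mulrCA ler_piMr ?invr_ge0 ?mulr_ge0 //.
    rewrite powRN -/(_ / _) ler_pdivrMr ?powR_gt0 ?mulr_gt0 // mul1r.
    apply: ge0_ler_powR; rewrite ?nnegrE ?mulr_ge0 //; first exact: ltW.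
    rewrite /B -natrM ler_nat mulnAC leq_mul2r; apply/orP; right.
    by apply: leq_trans (ltnW (proj2 (andP hk))) _; rewrite mulnDl leq_add2l leq_pmulr.
  rewrite big_const_seq count_predT iter_addr_0 -[leLHS]mulr_natl.
  by rewrite ler_pdivrMr ?mulr_gt0 // mul1r -natrM ler_nat.
have hs k : k \in t -> (r <= k)%N.
  by move=> /ht /andP[h _]; exact: leq_trans (leq_addl _ _) h.
have tO k : k \in t -> (k, r) \notin Om by rewrite mem_filter => /andP[].
apply: le_trans (method_error_fooling ut hs p1 d0 a0 s1 psi2 tO hsum r0).
rewrite lee_fin; apply: le_trans (ler_wpM2l a0 (fooling_norm_ge N0 tN ht)).
rewrite -/D -/Cr le_eqVlt; apply/orP; left; apply/eqP.
rewrite /a !powRM // ?(ltW B0) //.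
have -> : N%:R `^ (- mu + 2 * r%:R - s^-1 + 2^-1)
  = N%:R `^ (- s^-1) * N%:R `^ (- mu) * N%:R `^ (2 * r%:R + 2^-1) :> R.
  rewrite -!powRD; [|by apply/implyP => _; rewrite gt_eqF..].
  by congr (_ `^ _); ring.
by ring.
Qed.

End LowerBound.

(** * Hyperbolic crosses and the truncation error *)

Section RealPowers.
Variable R : realType.

Lemma powRD_gt0 (x a b : R) : 0 < x -> x `^ (a + b) = x `^ a * x `^ b.
Proof. by move=> x0; rewrite powRD //; apply/implyP => _; rewrite gt_eqF. Qed.

Lemma le_powR_neg (x y a : R) : 0 < x -> x <= y -> 0 <= a -> y `^ (- a) <= x `^ (- a).
Proof.
move=> x0 xy a0; rewrite !powRN lef_pV2 ?posrE ?powR_gt0 ?(lt_le_trans x0) //.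
by apply: ge0_ler_powR; rewrite ?nnegrE ?(ltW x0) ?(ltW (lt_le_trans x0 xy)).
Qed.

Lemma le_powR2 (x y e : R) : 0 <= x -> x <= y -> 0 <= e -> x `^ e <= y `^ e.
Proof.
by move=> x0 xy e0; apply: ge0_ler_powR; rewrite ?nnegrE // (le_trans x0).
Qed.

Lemma powR_exprn (x a : R) (n : nat) : 0 <= x -> (x ^+ n) `^ a = (x `^ a) ^+ n.
Proof.
move=> x0; rewrite -(powR_mulrn n x0) -(powR_mulrn n (powR_ge0 x a)).
by rewrite -!powRrM mulrC.
Qed.

(* Replaces Hoelder's inequality for all exponents at once, [s = 1] included:
   either [u <= tau], or [u ^ (1 - s) <= tau ^ (1 - s)]. *)
Lemma young_shift (u tau s : R) : 0 <= u -> 0 < tau -> 1 <= s ->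
  u <= tau `^ (1 - s) * u `^ s + tau.
Proof.
move=> u0 t0 s1; have [ut|tu] := leP u tau.
  by rewrite ler_wpDl // mulr_ge0 ?powR_ge0.
have up : 0 < u by apply: lt_trans tu.
rewrite ler_wpDr ?(ltW t0) //.
have e : u `^ s = u * u `^ (s - 1).
  rewrite -{2}[u](powRr1 (ltW up)) -powRD; first by congr (_ `^ _); ring.
  by apply/implyP => _; rewrite gt_eqF.
rewrite e mulrCA ler_peMr ?(ltW up) // -[1 - s]opprB powRN mulrC ler_pdivlMr ?powR_gt0 // mul1r.
by apply: ge0_ler_powR; rewrite ?nnegrE ?subr_ge0 // ltW.
Qed.

End RealPowers.

Section HyperbolicCounting.
Variable R : realType.
Implicit Types (i : nat * nat) (t : seq (nat * nat)).

Lemma harmonic_sum_le M : (0 < M)%N ->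
  \sum_(1 <= k < M.+1) (k%:R^-1 : R) <= 1 + ln M%:R.
Proof.
elim: M => // -[_ _|M IH _].
  by rewrite big_nat1 invr1 ln1 addr0.
rewrite big_nat_recr //=; apply: le_trans (lerD (IH isT) (lexx _)) _.
rewrite -addrA lerD2l; set x := M.+2%:R : R.
have x0 : 0 < x by rewrite ltr0n.
(* The induction step is 1/x <= - ln (1 - 1/x) = ln x - ln (x - 1). *)
have e : M.+1%:R = x * (1 - x^-1) :> R.
  by rewrite mulrBr mulr1 mulfV ?gt_eqF // /x -[M.+2]addn1 natrD addrK.
have h1 : 0 < 1 - x^-1.
  by rewrite -(pmulr_rgt0 _ x0) -e ltr0n.
have h : ln (1 - x^-1) <= - x^-1.
  by apply: le_ln1Dx; rewrite ltrN2 -subr_gt0.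
rewrite e lnM ?posrE // -addrA gerDl -lerBrDr sub0r.
by [].
Qed.

(** Row k of the cross has at most M / k points, and the harmonic sum produces the logarithm. *)
Lemma hyperbolic_count t M : (0 < M)%N -> uniq t ->
  {in t, forall i, [&& (0 < i.1)%N, (0 < i.2)%N & (i.1 * i.2 <= M)%N]} ->
  (size t)%:R <= M%:R * (1 + ln M%:R) :> R.
Proof.
move=> M0 ut ht.
have h1 : (size t <= \sum_(1 <= k < M.+1) M %/ k)%N.
  have hs : {subset t <= [seq (k, j) | k <- iota 1 M, j <- iota 1 (M %/ k)]}.
    move=> [k j] /ht /and3P[/= k0 j0 kj].
    apply/allpairsPdep; exists k, j; split => //; rewrite mem_iota.
      by rewrite k0 /= add1n ltnS (leq_trans _ kj) // leq_pmulr.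
    by rewrite j0 /= add1n ltnS leq_divRL // mulnC.
  apply: leq_trans (uniq_leq_size ut hs) _.
  rewrite size_allpairs_dep sumnE big_map /index_iota subSS subn0.
  by under eq_bigr do rewrite size_iota.
have Mp : 0 < M%:R :> R by rewrite ltr0n.
apply: le_trans (ler_wpM2l (ltW Mp) (harmonic_sum_le M0)).
apply: (@le_trans _ _ (\sum_(1 <= k < M.+1) M %/ k)%:R); first by rewrite ler_nat.
rewrite natr_sum mulr_sumr big_nat_cond [leRHS]big_nat_cond.
apply: ler_sum => k /andP[/andP[k0 _] _].
by rewrite ler_pdivlMr ?ltr0n // -natrM ler_nat leq_trunc_div.
Qed.

(** Multiplication by (1 - q)^2 makes the sum telescope to an expression that is at most 1. *)
Lemma arith_geometric_sum_le (q : R) n : 0 <= q -> q < 1 ->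
  \sum_(0 <= l < n) (l.+1%:R * q ^+ l) <= (1 - q) ^- 2.
Proof.
move=> q0 q1; have p0 : 0 < (1 - q) ^+ 2 by rewrite exprn_gt0 // subr_gt0.
have e : (1 - q) ^+ 2 * \sum_(0 <= l < n) (l.+1%:R * q ^+ l)
    = 1 - n.+1%:R * q ^+ n + n%:R * q ^+ n.+1.
  elim: n => [|n IH]; first by rewrite big_geq // expr0; ring.
  by rewrite big_nat_recr //= mulrDr IH -!natr1 !exprS; ring.
rewrite -[leLHS](mulKf (lt0r_neq0 p0)) e -[leRHS]mulr1 ler_wpM2l ?invr_ge0 ?(ltW p0) //.
have h : n%:R * q ^+ n.+1 <= n.+1%:R * q ^+ n.
  apply: ler_pM => //; first by rewrite exprn_ge0.
    by rewrite ler_nat.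
  by rewrite exprS ler_piMl ?exprn_ge0 // ltW.
lra.
Qed.

(** Shell l has at most 2^(l+1) M (1 + ln (2^(l+1) M)) points, each contributing at most (2^l
    M)^(-1-b). The shells thus decay like (l + 1) q^l with q = 2^(-b). In the constant 4, one factor
    2 is the ratio of the shell radii, the other comes from lam + (l + 1) <= 2 lam (l + 1). *)
Lemma hyperbolic_tail (b : R) : 0 < b ->
  exists C, 0 < C /\ forall t M, (0 < M)%N -> uniq t ->
  {in t, forall i, [&& (0 < i.1)%N, (0 < i.2)%N & (M <= i.1 * i.2)%N]} ->
  \sum_(i <- t) (i.1 * i.2)%:R `^ (- 1 - b) <= C * (M%:R `^ (- b) * (1 + ln M%:R)).
Proof.
move=> b0; pose q : R := 2 `^ (- b).
have q0 : 0 < q by rewrite powR_gt0.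
have q1 : q < 1.
  have h : 1 `^ b < 2 `^ b :> R by apply: gt0_ltr_powR; rewrite ?nnegrE // ltr1n.
  by move: h; rewrite powR1 /q powRN invf_lt1 ?powR_gt0.
exists (4 * (1 - q) ^- 2); split.
  by rewrite mulr_gt0 // invr_gt0 exprn_gt0 // subr_gt0.
move=> t M M0 ut ht.
have Mp : 0 < M%:R :> R by rewrite ltr0n.
set lam := 1 + ln M%:R; have lam1 : 1 <= lam by rewrite lerDl ln_ge0 // ler1n.
have lam0 : 0 <= lam by exact: le_trans lam1.
(* dyadic shells [2 ^ l * M <= i.1 * i.2 < 2 ^ (l + 1) * M] *)
have main L : \sum_(i <- t | (i.1 * i.2 < 2 ^ L * M)%N) (i.1 * i.2)%:R `^ (- 1 - b)
   <= 4 * (M%:R `^ (- b) * lam) * \sum_(0 <= l < L) (l.+1%:R * q ^+ l).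
  elim: L => [|L IH].
    rewrite big_geq // mulr0 big_seq_cond big1 // => i /andP[/ht /and3P[_ _ h]].
    by rewrite mul1n ltnNge h.
  rewrite big_nat_recr //= mulrDr.
  rewrite (bigID (fun i => (i.1 * i.2 < 2 ^ L * M)%N)) /=; apply: lerD.
    rewrite (eq_bigl (fun i => (i.1 * i.2 < 2 ^ L * M)%N)) // => i.
    apply: andb_idl => h; apply: leq_trans h _.
    by rewrite leq_mul2r leq_exp2l // leqnSn orbT.
  rewrite -big_filter; set t' := [seq i <- t | _].
  have ut' : uniq t' by rewrite filter_uniq.
  have cnt : (size t')%:R <= (2 ^ L.+1 * M)%:R * (1 + ln (2 ^ L.+1 * M)%:R) :> R.
    apply: hyperbolic_count => //; first by rewrite muln_gt0 expn_gt0.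
    move=> i; rewrite mem_filter => /andP[/andP[h1 _] /ht /and3P[-> -> _]] /=.
    exact: ltnW.
  have A0 : 0 < (2 ^ L * M)%:R :> R by rewrite ltr0n muln_gt0 expn_gt0.
  apply: (@le_trans _ _ (\sum_(i <- t') (2 ^ L * M)%:R `^ (- 1 - b))).
    rewrite big_seq [leRHS]big_seq; apply: ler_sum => i.
    rewrite mem_filter -leqNgt => /andP[/andP[_ h] _].
    rewrite -opprD !powRN lef_pV2 ?posrE ?powR_gt0 ?(lt_le_trans A0) ?ler_nat //.
    by apply: ge0_ler_powR; rewrite ?nnegrE ?ler_nat ?addr_ge0 ?(ltW b0).
  rewrite big_const_seq count_predT iter_addr_0 -[leLHS]mulr_natl.
  apply: le_trans (ler_wpM2r (powR_ge0 _ _) cnt) _.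
  have -> : (2 ^ L * M)%:R `^ (- 1 - b) = (2 ^ L * M)%:R^-1 * (q ^+ L * M%:R `^ (- b)) :> R.
    rewrite powRD; last by apply/implyP => _; rewrite gt_eqF.
    rewrite powR_inv1 ?ltW //; congr (_ * _).
    rewrite natrM powRM ?ler0n // natrX; congr (_ * _).
    exact: powR_exprn.
  have l2 : ln (2 ^ L.+1 * M)%:R <= L.+1%:R + ln M%:R :> R.
    rewrite natrM lnM ?posrE ?ltr0n ?expn_gt0 // lerD2r natrX lnXn //.
    rewrite -[leLHS]mulr_natl -[leRHS]mulr1 ler_wpM2l //.
    apply: (@le_ln1Dx R 1); lra.
  have eA : (2 ^ L.+1 * M)%:R = 2 * (2 ^ L * M)%:R :> R by rewrite expnS -mulnA natrM.
  rewrite eA in l2 *; move: A0 l2; move: (2 ^ L * M)%:R => A A0 l2.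
  rewrite [leLHS](_ : _ = 2 * (1 + ln (2 * A)) * (q ^+ L * M%:R `^ (- b))); last first.
    by field; rewrite gt_eqF.
  rewrite [leRHS](_ : _ = (4 * lam * L.+1%:R) * (q ^+ L * M%:R `^ (- b))); last by ring.
  rewrite ler_wpM2r ?mulr_ge0 ?powR_ge0 ?exprn_ge0 ?(ltW q0) //.
  have L1 : 1 <= L.+1%:R :> R by rewrite ler1n.
  have : lam <= lam * L.+1%:R by rewrite ler_peMr // (le_trans _ lam1).
  have : L.+1%:R <= lam * L.+1%:R by rewrite ler_peMl.
  move: l2; rewrite /lam => *; lra.
(* As m < 2^m, the first m shells already contain every point of the finite list. *)
pose m := \max_(i <- t) (i.1 * i.2).
have hm i : i \in t -> (i.1 * i.2 < 2 ^ m * M)%N.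
  move=> it; have : (i.1 * i.2 <= m)%N by rewrite /m (big_rem i it) /= leq_maxl.
  move/leq_ltn_trans; apply; apply: leq_trans (ltn_expl m (isT : (1 < 2)%N)) _.
  exact: leq_pmulr.
have := main m; rewrite big_seq_cond.
rewrite (eq_bigl (fun i => i \in t)) => [|i]; last by apply: andb_idr => /hm.
rewrite -big_seq => /le_trans; apply.
rewrite [leRHS]mulrAC ler_wpM2l ?mulr_ge0 ?powR_ge0 // ?(le_trans _ lam1) //.
apply: arith_geometric_sum_le => //; exact: ltW.
Qed.

End HyperbolicCounting.

(** * Truncation error: tail and propagated noise *)

Section UpperBound.
Variables (R : realType) (r : nat).
Hypothesis r0 : (0 < r)%N.
Implicit Types (i : nat * nat) (t : seq (nat * nat)).
Notation deg_ge i := ((r <= i.1)%N && (r <= i.2)%N).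

(** A majorant of [dlegendre_norm2] that depends on the pair only through its product, as the
    smoothness weight does; 4 r is sqrt (4 r) once per variable. *)
Definition dweight i : R := (4 * r)%:R * (i.1 * i.2)%:R `^ (2 * r%:R - 2^-1).

Lemma dlegendre_norm2_le i : deg_ge i -> dlegendre_norm2 R r i <= dweight i.
Proof.
move=> /andP[i1 i2].
have p1 : (0 < i.1)%N by apply: leq_trans i1.
have p2 : (0 < i.2)%N by apply: leq_trans i2.
rewrite /dlegendre_norm2 /dweight.
set e := (4 * r - 1)%N.
have ee : 2 * r%:R - 2^-1 = e%:R * 2^-1 :> R.
  by rewrite /e natrB ?muln_gt0 // natrM; field.
have P0 : 0 <= (i.1 * i.2)%:R `^ (2 * r%:R - 2^-1) :> R by exact: powR_ge0.
rewrite -[leRHS]ger0_norm ?mulr_ge0 // -sqrtr_sqr ler_wsqrtr //.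
apply: le_trans (ler_pM (pint_sqr_ge0 _) (pint_sqr_ge0 _)
   (legendre_derivn_norm_le R p1 r0) (legendre_derivn_norm_le R p2 r0)) _.
have eP : ((i.1 * i.2)%:R `^ (2 * r%:R - 2^-1)) ^+ 2 = (i.1 * i.2)%:R ^+ e :> R.
  rewrite -(powR_mulrn 2 P0) -powRrM ee -(powR_mulrn e) // .
  by rewrite -[e%:R * _ * _]mulrA mulVf ?mulr1.
by rewrite exprMn eP [(i.1 * i.2)%:R]natrM [X in _ <= _ * X]exprMn -/e expr2 mulrACA.
Qed.

Variables (s mu : R).
Hypotheses (s1 : 1 <= s) (hmu : 2 * r%:R - s^-1 + 2^-1 < mu).
Let b := mu - 2 * r%:R + s^-1 - 2^-1.
Let b0 : 0 < b. Proof. by rewrite /b; move: hmu; lra. Qed.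
Let s0 : 0 < s. Proof. exact: lt_le_trans s1. Qed.

(** For M = 1 this bounds the whole series, which gives its convergence; for M = r n it is the
    truncation tail. *)
Lemma coef_tail_sum_le : exists C, 0 < C /\ forall f t M, smooth_class s mu f ->
  (0 < M)%N -> uniq t -> {in t, forall i, deg_ge i && (M <= i.1 * i.2)%N} ->
  \sum_(i <- t) `|coef f i| * dweight i
    <= C * (M%:R `^ (- b) * (1 + ln M%:R) `^ (1 - s^-1)).
Proof.
have [C [C0 hC]] := hyperbolic_tail b0.
exists ((4 * r)%:R * (1 + C)); split.
  by rewrite mulr_gt0 ?ltr0n ?muln_gt0 // addr_gt0.
move=> f t M [_ /(smooth_norm_le1 mu f s1) hf] M0 ut ht.
have Mp : 0 < M%:R :> R by rewrite ltr0n.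
set lam := 1 + ln M%:R; have lam1 : 1 <= lam by rewrite lerDl ln_ge0 // ler1n.
have lam0 : 0 < lam by exact: lt_le_trans lam1.
(* This value equalises the powers of lam in the two terms: tau^(1 - s) = tau lam = lam^(1 -
   1/s). *)
pose tau := lam `^ (- s^-1); have tau0 : 0 < tau by rewrite powR_gt0.
pose m i : R := (i.1 * i.2)%:R.
have mt i : i \in t -> M%:R <= m i.
  by move=> /ht /andP[_ h]; rewrite ler_nat.
have m0 i : i \in t -> 0 < m i by move=> /mt; exact: lt_le_trans.
pose U i := m i `^ (s * mu) * `|coef f i| `^ s.
have sU : \sum_(i <- t) U i <= 1.
  apply: le_trans (hf t ut); rewrite big_seq [leRHS]big_seq; apply: ler_sum => i it.
  have -> : (maxn 1 (i.1 * i.2) = i.1 * i.2)%N; last by [].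
  by apply/maxn_idPr; have := m0 i it; rewrite ltr0n.
have key i : i \in t -> `|coef f i| * dweight i <=
    (4 * r)%:R * (tau `^ (1 - s) * M%:R `^ (- b) * U i + tau * m i `^ (- 1 - b)).
  move=> it; have mi := m0 i it.
  rewrite /dweight mulrCA ler_wpM2l // -/(m i).
  (* this shift makes the first term at most [U i * M ^ (- b)] and turns the
     second one into the summable [tau * m i ^ (- 1 - b)] *)
  have y := young_shift (normr_ge0 (coef f i))
     (_ : 0 < tau * m i `^ (- s^-1 - mu)) s1.
  apply: le_trans (ler_wpM2r (powR_ge0 _ _) (y _)) _.
    by rewrite mulr_gt0 ?powR_gt0.
  rewrite mulrDl; apply: lerD; last first.
    rewrite -mulrA -powRD_gt0 //.
    by rewrite (_ : - s^-1 - mu + (2 * r%:R - 2^-1) = - 1 - b) // /b; lra.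
  rewrite powRM ?powR_ge0 ?(ltW tau0) // -powRrM /U.
  have ex : m i `^ ((- s^-1 - mu) * (1 - s)) * m i `^ (2 * r%:R - 2^-1)
     = m i `^ (s * mu) * m i `^ (- b).
    rewrite -!powRD_gt0 //; congr (_ `^ _); rewrite /b.
    by field; rewrite gt_eqF.
  rewrite [leLHS](_ : _ = tau `^ (1 - s) * (m i `^ (s * mu) * `|coef f i| `^ s) * m i `^ (- b)).
    rewrite -[leRHS]mulrAC ler_wpM2l ?mulr_ge0 ?powR_ge0 //.
    by apply: le_powR_neg => //; [exact: mt|exact: ltW].
  rewrite [LHS](_ : _ = tau `^ (1 - s) * `|coef f i| `^ s *
    (m i `^ ((- s^-1 - mu) * (1 - s)) * m i `^ (2 * r%:R - 2^-1))); last by ring.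
  by rewrite ex; ring.
apply: (@le_trans _ _ (\sum_(i <- t)
   (4 * r)%:R * (tau `^ (1 - s) * M%:R `^ (- b) * U i + tau * m i `^ (- 1 - b)))).
  by rewrite big_seq [leRHS]big_seq; apply: ler_sum.
rewrite -mulr_sumr -mulrA ler_wpM2l // big_split /= -!mulr_sumr.
have hC' : \sum_(i <- t) m i `^ (- 1 - b) <= C * (M%:R `^ (- b) * lam).
  apply: hC => // i /ht /andP[/andP[h1 h2] h3].
  by rewrite h3 (leq_trans r0 h1) (leq_trans r0 h2).
have e1 : tau `^ (1 - s) = lam `^ (1 - s^-1).
  rewrite -powRrM; congr (_ `^ _).
  by field; rewrite gt_eqF.
have e2 : tau * lam = lam `^ (1 - s^-1).
  by rewrite /tau -[X in _ * X](powRr1 (ltW lam0)) -powRD_gt0 // addrC.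
rewrite mulrDl mul1r; apply: lerD.
  by rewrite e1 [leRHS]mulrC -[leRHS]mulr1 ler_wpM2l ?mulr_ge0 ?powR_ge0.
apply: le_trans (ler_wpM2l (ltW tau0) hC') _.
by rewrite -e2 le_eqVlt; apply/orP; left; apply/eqP; ring.
Qed.

Lemma noise_sum_le (p : \bar R) (delta : R) f x t M : (1 <= p)%E -> 0 < delta ->
  admissible p delta f x -> (0 < M)%N -> uniq t ->
  {in t, forall i, deg_ge i && (i.1 * i.2 <= M)%N} ->
  \sum_(i <- t) `|coef f i - x i| * dweight i
   <= (8 * r)%:R * (delta * (M%:R `^ (2 * r%:R - 2^-1)
        * (M%:R * (1 + ln M%:R)) `^ (1 - recip p))).
Proof.
move=> p1 d0 hx M0 ut ht.
have Mp : 0 < M%:R :> R by rewrite ltr0n.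
set lam := 1 + ln M%:R; have lam1 : 1 <= lam by rewrite lerDl ln_ge0 // ler1n.
have lam0 : 0 < lam by exact: lt_le_trans lam1.
set g := 2 * r%:R - 2^-1.
have g0 : 0 <= g.
  have : (1 : R) <= r%:R by rewrite ler1n.
  by rewrite /g; lra.
set A := M%:R * lam; have A0 : 0 < A by rewrite mulr_gt0.
have cnt : (size t)%:R <= A.
  apply: hyperbolic_count => // i /ht /andP[/andP[h1 h2] ->].
  by rewrite (leq_trans r0 h1) (leq_trans r0 h2).
have wM i : i \in t -> dweight i <= (4 * r)%:R * M%:R `^ g.
  move=> /ht /andP[_ h]; rewrite /dweight ler_wpM2l //.
  by apply: ge0_ler_powR; rewrite ?nnegrE // ler_nat.
(* The weight is replaced by its maximum over the cross, leaving an unweighted sum of errors. The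
   constant 8 r is 4 r from the weight times 2 from the two terms below. *)
have suff_ : \sum_(i <- t) `|coef f i - x i| <= 2 * (delta * A `^ (1 - recip p)) ->
   \sum_(i <- t) `|coef f i - x i| * dweight i
     <= (8 * r)%:R * (delta * (M%:R `^ g * A `^ (1 - recip p))).
  move=> h; apply: (@le_trans _ _ (\sum_(i <- t) `|coef f i - x i| * ((4 * r)%:R * M%:R `^ g))).
    by rewrite big_seq [leRHS]big_seq; apply: ler_sum => i it; rewrite ler_wpM2l // wM.
  rewrite -mulr_suml; apply: le_trans (ler_wpM2r _ h) _; first by rewrite mulr_ge0 ?powR_ge0.
  have -> : (8 * r)%:R = 2 * (4 * r)%:R :> R by rewrite -natrM mulnA.
  by rewrite le_eqVlt; apply/orP; left; apply/eqP; ring.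
apply: suff_; case: p p1 hx => [p| |] //= p1 hx; last first.
  rewrite subr0 powRr1 ?(ltW A0) //.
  apply: (@le_trans _ _ (\sum_(i <- t) delta)).
    by apply: ler_sum => i _; exact: admissible_pinfty hx i.
  rewrite big_const_seq count_predT iter_addr_0 -[leLHS]mulr_natr.
  apply: le_trans (ler_wpM2l (ltW d0) cnt) _.
  have : 0 <= delta * A by rewrite mulr_ge0 ?(ltW d0) ?(ltW A0).
  lra.
move: p1; rewrite lee_fin => p1; have p0 : 0 < p by exact: lt_le_trans p1.
have hs := admissible_fin p1 (ltW d0) hx ut.
(* With this value both tau^(1 - p) delta^p and tau A equal delta A^(1 - 1/p). *)
pose tau := delta * A `^ (- p^-1).
have tau0 : 0 < tau by rewrite mulr_gt0 ?powR_gt0.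
apply: (@le_trans _ _ (\sum_(i <- t) (tau `^ (1 - p) * `|coef f i - x i| `^ p + tau))).
  by apply: ler_sum => i _; exact: young_shift.
rewrite big_split /= -mulr_sumr big_const_seq count_predT iter_addr_0 -[X in _ + X]mulr_natr.
rewrite mulrDl mul1r; apply: lerD.
  apply: le_trans (ler_wpM2l (powR_ge0 _ _) hs) _.
  rewrite /tau powRM ?powR_ge0 ?(ltW d0) // -powRrM mulrAC -powRD_gt0 // subrK powRr1 ?(ltW d0) //.
  rewrite le_eqVlt; apply/orP; left; apply/eqP; congr (_ * _ `^ _).
  by field; rewrite gt_eqF.
apply: le_trans (ler_wpM2l (ltW tau0) cnt) _.
rewrite /tau -mulrA -[X in _ * (_ * X)](powRr1 (ltW A0)) -powRD_gt0 //.
by rewrite addrC.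
Qed.

Lemma method_error_truncation_le : exists C, 0 < C /\ forall (p : \bar R) (delta : R) (n : nat),
  (1 <= p)%E -> 0 < delta -> (0 < n)%N ->
  (method_error r s mu p delta (@truncation R r n) <=
    (C * ((r * n)%:R `^ (- b) * (1 + ln (r * n)%:R) `^ (1 - s^-1)
       + delta * ((r * n)%:R `^ (2 * r%:R - 2^-1)
        * ((r * n)%:R * (1 + ln (r * n)%:R)) `^ (1 - recip p))))%:E)%E.
Proof.
have [C [C0 hC]] := coef_tail_sum_le.
exists (C + (8 * r)%:R); split; first by rewrite addr_gt0 // ltr0n muln_gt0.
move=> p delta n p1 d0 n0; apply: ge_ereal_sup => _ [f [x [hf hx ->]]].
set M := (r * n)%N; have M0 : (0 < M)%N by rewrite muln_gt0 r0.
set E1 := _ * _ `^ (1 - s^-1); set E2 := delta * _.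
have E10 : 0 <= E1 by rewrite mulr_ge0 ?powR_ge0.
have E20 : 0 <= E2 by rewrite !mulr_ge0 ?powR_ge0 ?(ltW d0).
have lnM : 0 <= 1 + ln M%:R :> R by rewrite addr_ge0 // ln_ge0 // ler1n.
set H := hyperbolic_cross r n.
have HE i : (i \in H) = deg_ge i && (i.1 * i.2 < M)%N.
  have hS : deg_ge i && (i.1 * i.2 < M)%N ->
      i \in [seq (k, j) | k <- iota 0 M.+1, j <- iota 0 M.+1].
    move=> /andP[/andP[h1 h2] h3].
    apply/allpairsP; exists i; rewrite !mem_iota !add0n !leq0n /=; split; last by case: (i).
      by rewrite ltnS ltnW // (leq_ltn_trans _ h3) // leq_pmulr // (leq_trans r0).
    by rewrite ltnS ltnW // (leq_ltn_trans _ h3) // leq_pmull // (leq_trans r0).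
  rewrite /H /hyperbolic_cross -/M; move: hS; move: [seq _ | _ <- _, _ <- _] => S hS.
  rewrite !inE; have -> : (i.1 * i.2 <= M - 1)%N = (i.1 * i.2 < M)%N by rewrite -ltnS subn1 prednK.
  by rewrite -[RHS](andb_idl hS) -!andbA.
have -> : truncation (galerkin H x) = (fun z => \sum_(i <- H) x i * legendre2 r i z).
  apply/funext => z; rewrite /truncation big_seq_fsetE /=.
  by apply: eq_bigr => i _; rewrite ffunE.
(* The bound for the whole series is the tail bound at M = 1. *)
apply: le_trans (@mixed_deriv_dist_le R r f x dweight (C * (1%:R `^ (- b) * (1 + ln 1%:R) `^ (1 - s^-1)))
   (C * E1) ((8 * r)%:R * E2) H _ _ _ _ _ _) _.
- exact: dlegendre_norm2_le.
- by move=> i; rewrite HE => /andP[].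
- by rewrite mulr_ge0 // ltW.
- move=> t ut ht; apply: hC => // i /ht /[dup] /andP[h1 h2] ->.
  by rewrite /= muln_gt0 (leq_trans r0 h1) (leq_trans r0 h2).
- move=> t ut ht; apply: hC => // i /ht /andP[h1]; rewrite HE h1 /= -leqNgt.
  by [].
- apply: noise_sum_le => //; first exact: fset_uniq.
  by move=> i; rewrite HE => /andP[-> /ltnW].
rewrite lee_fin mulrDr !mulrDl; move: (mulr_ge0 (ltW C0) E20).
have : 0 <= (8 * r)%:R * E1 by rewrite mulr_ge0.
lra.
Qed.

End UpperBound.

(** * Rates *)

Section Asymptotics.
Variables (R : realType) (a mu kappa : R).
Hypotheses (a0 : 0 < a) (mu0 : 0 < mu) (amu : a = mu - kappa).
Hypothesis kappa1 : `|kappa| <= 1.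
Implicit Types delta : R.

Definition Lof delta : R := ln delta^-1.
(** [Xof] is the order of the number N of data, and [Yof] that of the truncation parameter n, with
    kappa = 1/p - 1/s in the application. *)
Definition Xof delta : R := (delta^-1 * Lof delta `^ mu) `^ a^-1.
Definition Yof delta : R := (delta^-1 * Lof delta `^ kappa) `^ a^-1.

Lemma Lof_gt0 delta : 0 < delta < 1 -> 0 < Lof delta.
Proof. by move=> /andP[d0 d1]; rewrite ln_gt0 // invf_gt1. Qed.

(** Power identities between delta, [Lof], [Xof] and [Yof] are checked on logarithms, where they
    become linear. *)
Lemma ln_root delta e : 0 < delta < 1 ->
  ln ((delta^-1 * Lof delta `^ e) `^ a^-1) = (Lof delta + e * ln (Lof delta)) / a.
Proof.
move=> hd; have L0 := Lof_gt0 hd; have /andP[d0 d1] := hd.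
by rewrite ln_powR lnM ?posrE ?invr_gt0 ?powR_gt0 // ln_powR mulrC.
Qed.

Lemma ln_Xof delta : 0 < delta < 1 ->
  ln (Xof delta) = (Lof delta + mu * ln (Lof delta)) / a.
Proof. exact: ln_root. Qed.

Lemma ln_Yof delta : 0 < delta < 1 ->
  ln (Yof delta) = (Lof delta + kappa * ln (Lof delta)) / a.
Proof. exact: ln_root. Qed.

Lemma Xof_gt0 delta : 0 < delta < 1 -> 0 < Xof delta.
Proof.
move=> hd; have L0 := Lof_gt0 hd; have /andP[d0 d1] := hd.
by rewrite powR_gt0 // mulr_gt0 ?invr_gt0 ?powR_gt0.
Qed.

Lemma Yof_gt0 delta : 0 < delta < 1 -> 0 < Yof delta.
Proof.
move=> hd; have L0 := Lof_gt0 hd; have /andP[d0 d1] := hd.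
by rewrite powR_gt0 // mulr_gt0 ?invr_gt0 ?powR_gt0.
Qed.

(** The exponents mu and kappa differ by exactly a, so the a-th root leaves a single factor
    [Lof delta]. *)
Lemma Xof_Yof delta : 0 < delta < 1 -> Xof delta = Yof delta * Lof delta.
Proof.
move=> hd; have L0 := Lof_gt0 hd; have Y0 := Yof_gt0 hd; have X0 := Xof_gt0 hd.
have := ln_Xof hd; have := ln_Yof hd.
move: (Xof delta) (Yof delta) X0 Y0 => x y x0 y0 ly lx.
apply: ln_inj; rewrite ?posrE ?mulr_gt0 // lnM ?posrE // lx ly.
have -> : mu = a + kappa by rewrite amu subrK.
by field; rewrite gt_eqF.
Qed.

Lemma delta_Yof delta : 0 < delta < 1 ->
  delta = Yof delta `^ (- a) * Lof delta `^ kappa.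
Proof.
move=> hd; have L0 := Lof_gt0 hd; have Y0 := Yof_gt0 hd; have /andP[d0 d1] := hd.
have Ya0 := powR_gt0 (- a) Y0; have Lk0 := powR_gt0 kappa L0.
apply: ln_inj; rewrite ?posrE //; first exact: mulr_gt0.
rewrite lnM ?posrE //.
rewrite [ln (Yof delta `^ _)]ln_powR [ln (Lof delta `^ _)]ln_powR ln_Yof //.
have -> : ln delta = - Lof delta by rewrite /Lof lnV ?posrE // opprK.
by field; rewrite gt_eqF.
Qed.

Lemma powR_div_Xof delta b : 0 < delta < 1 ->
  (delta * Lof delta `^ (- mu)) `^ (b / a) = Xof delta `^ (- b).
Proof.
move=> hd; have L0 := Lof_gt0 hd; have X0 := Xof_gt0 hd; have /andP[d0 d1] := hd.
have Le0 := powR_gt0 (- mu) L0; have P0 := mulr_gt0 d0 Le0.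
have := ln_Xof hd; move: (Xof delta) X0 => x x0 lx.
apply: ln_inj; rewrite ?posrE ?powR_gt0 // !ln_powR lx lnM ?posrE // ln_powR.
have -> : ln delta = - Lof delta by rewrite /Lof lnV ?posrE // opprK.
by field; rewrite gt_eqF.
Qed.

Lemma powR_div_Yof delta b : 0 < delta < 1 ->
  (delta * Lof delta `^ (- kappa)) `^ (b / a) = Yof delta `^ (- b).
Proof.
move=> hd; have L0 := Lof_gt0 hd; have Y0 := Yof_gt0 hd; have /andP[d0 d1] := hd.
have Le0 := powR_gt0 (- kappa) L0; have P0 := mulr_gt0 d0 Le0.
have := ln_Yof hd; move: (Yof delta) Y0 => x x0 lx.
apply: ln_inj; rewrite ?posrE ?powR_gt0 // !ln_powR lx lnM ?posrE // ln_powR.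
have -> : ln delta = - Lof delta by rewrite /Lof lnV ?posrE // opprK.
by field; rewrite gt_eqF.
Qed.

(** This excludes the degenerate range near delta = 1. If L <= 1, taking logarithms in 1 <= c X
    gives mu ln L >= - a ln c - L >= - a ln c - 1, whence the value of [l]. *)
Lemma Lof_bounded_below c : 0 < c -> exists l0, [/\ 0 < l0, l0 <= 1 &
  forall delta, 0 < delta < 1 -> 1 <= c * Xof delta -> l0 <= Lof delta].
Proof.
move=> c0.
pose l := expR ((- a * ln c - 1) / mu).
exists (Num.min 1 l); split; first by rewrite lt_min ltr01 expR_gt0.
  by rewrite ge_min lexx.
move=> delta hd hX; have L0 := Lof_gt0 hd; have X0 := Xof_gt0 hd.
have [L1|L1] := leP 1 (Lof delta); first by rewrite ge_min L1.
rewrite ge_min; apply/orP; right.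
have h : 0 <= ln c + (Lof delta + mu * ln (Lof delta)) / a.
  by rewrite -ln_Xof // -lnM ?posrE // ln_ge0.
have h2 : - a * ln c - 1 <= mu * ln (Lof delta).
  have : 0 <= a * (ln c + (Lof delta + mu * ln (Lof delta)) / a).
    by rewrite mulr_ge0 // ltW.
  rewrite mulrDr mulrCA mulfV ?gt_eqF // mulr1; lra.
by rewrite /l -[leRHS]lnK ?posrE // ler_expR ler_pdivrMr // [leRHS]mulrC.
Qed.

Lemma ln_Lof_le l0 delta : 0 < l0 -> 0 < delta < 1 -> l0 <= Lof delta ->
  `|ln (Lof delta)| <= Lof delta + `|ln l0|.
Proof.
move=> l00 hd hL; have L0 := Lof_gt0 hd.
have h1 : ln l0 <= ln (Lof delta) by rewrite ler_ln ?posrE.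
have h2 : ln (Lof delta) <= Lof delta.
  have := @le_ln1Dx R (Lof delta - 1); rewrite [1 + _]addrC subrK => h.
  by apply: le_trans (h _) _; lra.
rewrite ler_norml; apply/andP; split.
  by apply: le_trans h1; have := ler_normr (- l0) (ln l0); have := lerNnormlW (lexx `|ln l0|); lra.
by apply: le_trans h2 _; rewrite lerDl.
Qed.

(** The sign of kappa is not known, so kappa ln L is controlled in absolute value. The lower bound
    keeps Y away from 0, the upper one compares ln Y with L. *)
Lemma ln_Yof_le l0 delta : 0 < l0 -> 0 < delta < 1 -> l0 <= Lof delta ->
  - (`|ln l0| / a) <= ln (Yof delta) <= (2 * Lof delta + `|ln l0|) / a.
Proof.
move=> l00 hd hL; have L0 := Lof_gt0 hd.
have h : `|kappa * ln (Lof delta)| <= Lof delta + `|ln l0|.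
  rewrite normrM; apply: le_trans (ln_Lof_le l00 hd hL).
  by rewrite ler_piMl.
rewrite ln_Yof //; move: h; rewrite ler_norml => /andP[h1 h2].
rewrite -mulNr !ler_pM2r ?invr_gt0 //; apply/andP; split; lra.
Qed.

(** Additive constants are absorbed through 1 <= L / l0. *)
Lemma ln_le_Lof l0 d rr : 0 < l0 -> 0 < d -> exists K, 0 < K /\ forall delta (n : nat),
  0 < delta < 1 -> l0 <= Lof delta -> (0 < n)%N -> (0 < rr)%N -> n%:R <= d * Yof delta ->
  1 + ln (rr * n)%:R <= K * Lof delta.
Proof.
move=> l00 d0.
pose c := 1 + `|ln (rr%:R : R)| + `|ln d| + `|ln l0| / a.
have c0 : 0 < c.
  by rewrite /c -!addrA ltr_pwDl // !addr_ge0 // divr_ge0 // ltW.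
exists (c / l0 + 2 / a); split.
  by rewrite addr_gt0 // divr_gt0.
move=> delta n hd hL n0 rr0 hn; have L0 := Lof_gt0 hd; have Y0 := Yof_gt0 hd.
have /andP[_ h1] := ln_Yof_le l00 hd hL.
have np : 0 < n%:R :> R by rewrite ltr0n.
have rp : 0 < rr%:R :> R by rewrite ltr0n.
have h2 : ln (n%:R : R) <= ln d + ln (Yof delta).
  by rewrite -lnM ?posrE // ler_ln ?posrE // mulr_gt0.
rewrite natrM lnM ?posrE //.
have h3 : c <= c / l0 * Lof delta.
  by rewrite mulrAC -mulrA ler_peMr ?(ltW c0) // ler_pdivlMr // mul1r.
have h4 : 2 / a * Lof delta + `|ln l0| / a = (2 * Lof delta + `|ln l0|) / a by ring.
rewrite mulrDl; move: h1; rewrite -h4 => h1.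
have h5 := ler_norm (ln (rr%:R : R)); have h6 := ler_norm (ln d).
move: h3; rewrite {1}/c; lra.
Qed.

(** Here additive constants are absorbed by ln N >= ln 2, which is where N > 1 enters. *)
Lemma Lof_le_ln l0 c : 0 < l0 -> 0 < c -> exists K, 0 < K /\ forall delta (N : nat),
  0 < delta < 1 -> l0 <= Lof delta -> (1 < N)%N -> c * Xof delta <= N%:R ->
  Lof delta <= K * ln N%:R.
Proof.
move=> l00 c0; pose e := a * `|ln c| + mu * `|ln l0|.
have e0 : 0 <= e by rewrite addr_ge0 // mulr_ge0 // ltW.
have ln2 : 0 < ln 2 :> R by rewrite ln_gt0 // ltr1n.
exists (a + e / ln 2); split; first by rewrite ltr_wpDr // divr_ge0 // ltW.
move=> delta N hd hL N1 hN; have L0 := Lof_gt0 hd; have X0 := Xof_gt0 hd.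
have Np : 0 < N%:R :> R by rewrite ltr0n (ltn_trans _ N1).
have h1 : ln c + (Lof delta + mu * ln (Lof delta)) / a <= ln N%:R.
  by rewrite -ln_Xof // -lnM ?posrE // ler_ln ?posrE // mulr_gt0.
have h2 : a * ln c + (Lof delta + mu * ln (Lof delta)) <= a * ln N%:R.
  have : a * (ln c + (Lof delta + mu * ln (Lof delta)) / a) <= a * ln N%:R.
    by rewrite ler_wpM2l // ltW.
  by rewrite mulrDr [a * (_ / a)]mulrCA mulfV ?gt_eqF // mulr1.
have h3 : - (a * `|ln c|) <= a * ln c.
  by rewrite -mulrN ler_wpM2l ?(ltW a0) // lerNnormlW.
have h4 : - (mu * `|ln l0|) <= mu * ln (Lof delta).
  rewrite -mulrN ler_wpM2l ?(ltW mu0) //.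
  apply: (@le_trans _ _ (ln l0)); first by rewrite lerNnormlW.
  by rewrite ler_ln ?posrE.
have h5 : ln 2 <= ln N%:R :> R by rewrite ler_ln ?posrE // ler_nat.
have h6 : e <= e / ln 2 * ln N%:R.
  by rewrite mulrAC -mulrA ler_peMr // ler_pdivlMr // mul1r.
rewrite mulrDl; move: h6; rewrite {1}/e; lra.
Qed.

End Asymptotics.

Section Rates.
Variables (R : realType) (a mu kappa : R).
Hypotheses (a0 : 0 < a) (mu0 : 0 < mu) (amu : a = mu - kappa).
Hypothesis kappa1 : `|kappa| <= 1.
Notation L := (@Lof R).
Notation X := (Xof a mu).
Notation Y := (Yof a kappa).

(** Substituting delta = Y^(- a) L^kappa turns the noise into Y^(g + 1 - rho - a) L^(kappa + 1 -
    rho), up to constants. The relations between the exponents make this Y^(- b) L^(1 - s'), the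
    order of the tail. *)
Lemma truncation_rate (b g rho s' l0 d1 d2 : R) (rr : nat) :
  0 <= b -> 0 <= g -> rho <= 1 -> s' <= 1 -> kappa = rho - s' ->
  g + 1 - rho - a = - b -> 0 < l0 -> 0 < d1 -> 0 < d2 -> (0 < rr)%N ->
  exists C : R, 0 < C /\ forall (delta : R) (n : nat), 0 < delta < 1 ->
    l0 <= L delta -> (0 < n)%N -> d1 * Y delta <= n%:R <= d2 * Y delta ->
    (rr * n)%:R `^ (- b) * (1 + ln (rr * n)%:R) `^ (1 - s')
       + delta * ((rr * n)%:R `^ g * ((rr * n)%:R * (1 + ln (rr * n)%:R)) `^ (1 - rho))
    <= C * (Y delta `^ (- b) * L delta `^ (3 / 2 - s')).
Proof.
move=> b0 g0 rho1 s1 kE gE l00 d10 d20 rr0.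
have [K [K0 hK]] := ln_le_Lof a0 kappa1 rr l00 d20.
have rp : 0 < rr%:R :> R by rewrite ltr0n.
pose A := d1 `^ (- b) * K `^ (1 - s').
pose B := (rr%:R * d2) `^ g * (rr%:R * d2 * K) `^ (1 - rho).
have A0 : 0 < A by rewrite mulr_gt0 ?powR_gt0.
have B0 : 0 < B by rewrite mulr_gt0 ?powR_gt0 ?mulr_gt0.
exists (l0 `^ (- 2^-1) * (A + B)); split.
  by rewrite mulr_gt0 ?powR_gt0 ?addr_gt0.
move=> delta n hd hL n0 /andP[h1 h2].
have L0 := Lof_gt0 hd; have Y0 : 0 < Y delta := Yof_gt0 a kappa hd.
have hlam := hK delta n hd hL n0 rr0 h2.
have /andP[dp _] := hd.
have np : 0 < n%:R :> R by rewrite ltr0n.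
set M : R := (rr * n)%:R in hlam *.
have ME : M = rr%:R * n%:R by rewrite /M natrM.
have M0 : 0 < M by rewrite ME mulr_gt0.
have M1 : 1 <= M by rewrite ler1n muln_gt0 rr0.
set lam := 1 + ln M in hlam *.
have lam0 : 0 < lam by rewrite ltr_pwDl // ln_ge0.
have nM : n%:R <= M by rewrite ME ler_peMl ?(ltW np) // ler1n.
have Md1 : d1 * Y delta <= M by exact: le_trans h1 nM.
have Md2 : M <= rr%:R * d2 * Y delta by rewrite ME -mulrA ler_wpM2l // ltW.
have dE := delta_Yof kappa a0 hd.
clear h1 h2 ME nM hK; clearbody M.
move: (Y delta) (L delta) Y0 L0 hL Md1 Md2 dE hlam => y l Y0 L0 hL Md1 Md2 dE hlam.
have t1 : M `^ (- b) * lam `^ (1 - s') <= A * (y `^ (- b) * l `^ (1 - s')).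
  have e1 : M `^ (- b) <= d1 `^ (- b) * y `^ (- b).
    rewrite -powRM ?(ltW d10) ?(ltW Y0) //; apply: le_powR_neg => //.
    exact: mulr_gt0.
  have e2 : lam `^ (1 - s') <= K `^ (1 - s') * l `^ (1 - s').
    by rewrite -powRM ?(ltW K0) ?(ltW L0) //; apply: le_powR2; rewrite ?(ltW lam0) ?subr_ge0.
  apply: le_trans (ler_pM (powR_ge0 _ _) (powR_ge0 _ _) e1 e2) _.
  by rewrite /A mulrACA.
have t2 : delta * (M `^ g * (M * lam) `^ (1 - rho)) <= B * (y `^ (- b) * l `^ (1 - s')).
  have e1 : M `^ g <= (rr%:R * d2) `^ g * y `^ g.
    by rewrite -powRM ?mulr_ge0 ?(ltW rp) ?(ltW d20) ?(ltW Y0) //; apply: le_powR2; rewrite ?(ltW M0).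
  have e2 : (M * lam) `^ (1 - rho) <=
      (rr%:R * d2 * K) `^ (1 - rho) * (y `^ (1 - rho) * l `^ (1 - rho)).
    rewrite -!powRM ?mulr_ge0 ?(ltW rp) ?(ltW d20) ?(ltW Y0) ?(ltW K0) ?(ltW L0) //.
    apply: le_powR2; rewrite ?mulr_ge0 ?(ltW M0) ?(ltW lam0) ?subr_ge0 //.
    by rewrite mulrACA; apply: ler_pM; rewrite ?(ltW M0) ?(ltW lam0).
  apply: (@le_trans _ _ (delta * ((rr%:R * d2) `^ g * y `^ g *
     ((rr%:R * d2 * K) `^ (1 - rho) * (y `^ (1 - rho) * l `^ (1 - rho)))))).
    by rewrite ler_wpM2l ?(ltW dp) //; apply: ler_pM; rewrite ?powR_ge0.
  rewrite {1}dE le_eqVlt; apply/orP; left; apply/eqP.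
  have -> : y `^ (- b) = y `^ (- a) * y `^ g * y `^ (1 - rho).
    by rewrite -!powRD_gt0 // -gE; congr (_ `^ _); ring.
  have -> : l `^ (1 - s') = l `^ kappa * l `^ (1 - rho).
    by rewrite -!powRD_gt0 // kE; congr (_ `^ _); ring.
  by rewrite /B; ring.
(* L may be smaller than 1, so passing to the larger exponent costs the factor l0^(-1/2). *)
have t3 : l `^ (1 - s') <= l0 `^ (- 2^-1) * l `^ (3 / 2 - s').
  have -> : 3 / 2 - s' = (1 - s') + 2^-1 by field.
  rewrite (powRD_gt0 (1 - s') 2^-1 L0) mulrCA ler_peMr ?powR_ge0 // powRN mulrC ler_pdivlMr ?powR_gt0 // mul1r.
  by apply: le_powR2; rewrite ?(ltW l00).
apply: le_trans (lerD t1 t2) _; rewrite -mulrDl.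
apply: (@le_trans _ _ ((A + B) * (y `^ (- b) * (l0 `^ (- 2^-1) * l `^ (3 / 2 - s'))))).
  by rewrite ler_wpM2l ?addr_ge0 ?(ltW A0) ?(ltW B0) // ler_wpM2l ?powR_ge0.
by rewrite le_eqVlt; apply/orP; left; apply/eqP; ring.
Qed.

(** Writing Y = X / L moves b powers of L into the logarithmic factor; for s' = 1/s the exponent b +
    3/2 - s' is mu - 2 r + 1. *)
Lemma upper_rates_le (b s' l0 c1 c2 : R) : 0 <= b -> 0 <= b + 3 / 2 - s' ->
  0 < l0 -> 0 < c1 -> 0 < c2 ->
  exists C : R, 0 < C /\ forall (delta : R) (N : nat), 0 < delta < 1 ->
    l0 <= L delta -> (1 < N)%N -> c1 * X delta <= N%:R <= c2 * X delta ->
    Y delta `^ (- b) * L delta `^ (3 / 2 - s')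
      <= C * (N%:R `^ (- b) * ln N%:R `^ (b + 3 / 2 - s')).
Proof.
move=> b0 k0 l00 c10 c20; set k := b + 3 / 2 - s' in k0 *.
have [K [K0 hK]] := Lof_le_ln a0 mu0 l00 c10.
exists (c2 `^ b * K `^ k); split; first by rewrite mulr_gt0 ?powR_gt0.
move=> delta N hd hL N1 /andP[h1 h2].
have L0 := Lof_gt0 hd; have Y0 : 0 < Y delta := Yof_gt0 a kappa hd.
have X0 : 0 < X delta := Xof_gt0 a mu hd.
have Np : 0 < N%:R :> R by rewrite ltr0n (ltn_trans _ N1).
have lN : 0 < ln N%:R :> R by rewrite ln_gt0 // ltr1n.
have YE : Y delta = X delta * (L delta)^-1.
  by rewrite (Xof_Yof a0 amu hd) mulfK // gt_eqF.
have e1 : Y delta `^ (- b) * L delta `^ (3 / 2 - s') = X delta `^ (- b) * L delta `^ k.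
  rewrite YE powRM ?(ltW X0) ?invr_ge0 ?(ltW L0) // -mulrA; congr (_ * _).
  rewrite -powR_inv1 ?(ltW L0) // -powRrM -powRD_gt0 //; congr (_ `^ _).
  by rewrite /k; ring.
rewrite e1 mulrACA; apply: ler_pM; rewrite ?powR_ge0 //.
  rewrite mulrC -[c2 `^ b]invrK -powRN ler_pdivlMr ?powR_gt0 // mulrC.
  rewrite -powRM ?(ltW X0) ?(ltW c20) //; exact: le_powR_neg.
rewrite -powRM ?(ltW K0) ?(ltW lN) //; apply: le_powR2; rewrite ?(ltW L0) //.
exact: hK.
Qed.

Lemma cross_size_choice (r : nat) (l0 c1 : R) : (0 < r)%N -> 0 < l0 -> 0 < c1 ->
  exists d1 d2 : R, [/\ 0 < d1, 0 < d2 & forall (delta : R) (N : nat),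
    0 < delta < 1 -> l0 <= L delta -> (0 < N)%N -> c1 * X delta <= N%:R ->
    exists n : nat, [/\ (0 < n)%N, d1 * Y delta <= n%:R <= d2 * Y delta &
      (#|` hyperbolic_cross r n| <= N)%N]].
Proof.
move=> r0 l00 c10.
have [K [K0 hK]] := ln_le_Lof a0 kappa1 r l00 (@ltr01 R).
have rp : 0 < r%:R :> R by rewrite ltr0n.
(* The second entry makes the count r n K L at most c1 Y L = c1 X <= N; the first ensures n <= Y,
   for which [K] was chosen. *)
pose d := Num.min 1 (c1 / (r%:R * K)).
have dp : 0 < d by rewrite lt_min ltr01 divr_gt0 // mulr_gt0.
pose y0 := expR (- (`|ln l0| / a)).
have y00 : 0 < y0 by exact: expR_gt0.
(* Rounding down a number that is at least 1 loses at most half of it, whence d / 2. The summand 1 /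
   y0 covers n = 1, since Y >= y0. *)
exists (d / 2), (d + y0^-1); split.
- by rewrite divr_gt0.
- by rewrite addr_gt0 ?invr_gt0.
move=> delta N hd hL N0 hN.
have L0 := Lof_gt0 hd; have Y0 : 0 < Y delta := Yof_gt0 a kappa hd.
have Yy : y0 <= Y delta.
  have /andP[h _] := ln_Yof_le a0 kappa1 l00 hd hL.
  by rewrite /y0 -[leRHS]lnK ?posrE // ler_expR.
have [dY|dY] := ltP (d * Y delta) 1.
  (* for [n = 1] the hyperbolic cross is empty, as [k j >= r] there *)
  exists 1%N; split => //.
    rewrite mulrAC mulrDl; apply/andP; split.
      by rewrite ler_pdivrMr // mul1r; apply: le_trans (ltW dY) _; rewrite ler1n.
    rewrite ler_wpDl ?mulr_ge0 ?(ltW dp) ?(ltW Y0) // mulrC ler_pdivlMr // mul1r //.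
  rewrite (_ : hyperbolic_cross r 1 = fset0) ?cardfs0 //.
  apply/fsetP => i; rewrite /hyperbolic_cross.
  move: [seq _ | _ <- _, _ <- _] => S; rewrite !inE.
  apply/negP => /andP[_ /and3P[h1 h2 h3]].
  have h4 : (r <= i.1 * i.2)%N by apply: leq_trans h1 _; rewrite leq_pmulr // (leq_trans r0).
  by have := leq_trans h4 h3; rewrite muln1 subn1 leqNgt ltn_predL r0.
pose n := Num.truncn (d * Y delta).
have [n1 n2] : n%:R <= d * Y delta /\ d * Y delta < n.+1%:R.
  by have /andP[] := truncn_itv (ltW (lt_le_trans ltr01 dY)).
have n0 : (0 < n)%N.
  rewrite -ltnS -(ltr_nat R); exact: le_lt_trans dY n2.
have np : 1 <= n%:R :> R by rewrite ler1n.
exists n; split => //.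
  apply/andP; split.
    by rewrite mulrAC ler_pdivrMr //; apply: ltW; apply: lt_le_trans n2 _; rewrite -natr1; lra.
  apply: le_trans n1 _; rewrite ler_wpM2r ?(ltW Y0) // lerDl invr_ge0 ltW //.
have nY : n%:R <= 1 * Y delta.
  by apply: le_trans n1 _; rewrite ler_wpM2r ?(ltW Y0) // ge_min lexx.
have lam := hK delta n hd hL n0 r0 nY.
rewrite -(ler_nat R).
have cnt : (#|` hyperbolic_cross r n|)%:R <= (r * n)%:R * (1 + ln (r * n)%:R) :> R.
  apply: hyperbolic_count; rewrite ?muln_gt0 ?r0 ?fset_uniq //.
  move=> i; rewrite /hyperbolic_cross; move: [seq _ | _ <- _, _ <- _] => S.
  rewrite !inE => /andP[_ /and3P[h1 h2 h3]].
  by rewrite (leq_trans r0 h1) (leq_trans r0 h2) /= (leq_trans h3) // leq_subr.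
apply: le_trans cnt _.
apply: le_trans (ler_wpM2l (ler0n _ _) lam) _.
apply: le_trans hN; rewrite (Xof_Yof a0 amu hd) natrM.
have n3 : n%:R <= c1 / (r%:R * K) * Y delta.
  by apply: le_trans n1 _; rewrite ler_wpM2r ?(ltW Y0) // ge_min lexx orbT.
apply: (@le_trans _ _ (r%:R * (c1 / (r%:R * K) * Y delta) * (K * L delta))).
  by rewrite ler_wpM2r ?mulr_ge0 ?(ltW K0) ?(ltW L0) // ler_wpM2l ?(ltW rp).
rewrite le_eqVlt; apply/orP; left; apply/eqP.
by field; rewrite !gt_eqF.
Qed.

End Rates.

(** * Two-sided bounds for the minimal radius *)

Lemma inL2_truncation (R : realType) (r n : nat) (c : {ffun hyperbolic_cross r n -> R}) :
  inL2 (truncation c).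
Proof.
pose c' (i : nat * nat) : R := if insub i is Some j then c j else 0.
have -> : truncation c = (fun z => \sum_(i <- hyperbolic_cross r n) c' i * legendre2 r i z).
  apply/funext => z; rewrite /truncation big_seq_fsetE /=.
  by apply: eq_bigr => i _; rewrite /c' valK.
have [m1 n1] := @normL2_sum R r (hyperbolic_cross r n) c' _ (fun i _ => lexx _).
by apply/inL2P; split => //; apply: le_lt_trans n1 (ltry _).
Qed.

Theorem theorem0p4p4 (R : realType) (r : nat) (s mu : R) (p : \bar R)
    (hr : (1 <= r)%N) (hs : 1 <= s) (hp : (1 <= p)%E)
    (hmu : 2 * r%:R - s^-1 + 2^-1 < mu) :
  let a := mu - recip p + s^-1 in
  let b := mu - 2 * r%:R + s^-1 - 2^-1 in
  let L := fun delta : R => ln delta^-1 in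
  let X := fun delta : R => (delta^-1 * L delta `^ mu) `^ a^-1 in
  let Y := fun delta : R => (delta^-1 * L delta `^ (recip p - s^-1)) `^ a^-1 in
  let lowerN := fun N : nat => N%:R `^ (- mu + 2 * r%:R - s^-1 + 2^-1) in
  let upperN := fun N : nat =>
    N%:R `^ (- mu + 2 * r%:R - s^-1 + 2^-1)
      * ln N%:R `^ (mu - 2 * r%:R + 1) in
  let lowerD := fun delta : R => (delta * L delta `^ (- mu)) `^ (b / a) in
  let upperD := fun delta : R =>
    (delta * L delta `^ (s^-1 - recip p)) `^ (b / a)
      * L delta `^ (3 / 2 - s^-1) in
  forall c1 c2 : R, 0 < c1 -> 0 < c2 ->
  (* the two-sided bounds, in terms of N and in terms of delta *)
  (exists c C : R, [/\ 0 < c, 0 < C &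
     forall (delta : R) (N : nat), 0 < delta < 1 ->
       c1 * X delta <= N%:R <= c2 * X delta ->
       [/\ ((c * lowerN N)%:E <= galerkin_radius r s mu p N delta)%E,
           (1 < N)%N ->
             (galerkin_radius r s mu p N delta <= (C * upperN N)%:E)%E,
           ((c * lowerD delta)%:E <= galerkin_radius r s mu p N delta)%E &
           (galerkin_radius r s mu p N delta <= (C * upperD delta)%:E)%E]])
  /\
  (* the truncation method with n of order Y attains the upper bounds *)
  (forall d1 d2 : R, 0 < d1 -> 0 < d2 ->
     exists C : R, 0 < C /\
     forall (delta : R) (N n : nat), 0 < delta < 1 ->
       c1 * X delta <= N%:R <= c2 * X delta ->
       d1 * Y delta <= n%:R <= d2 * Y delta ->
       ((1 < N)%N ->
          (method_error r s mu p delta (@truncation R r n)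
             <= (C * upperN N)%:E)%E) /\
       (method_error r s mu p delta (@truncation R r n)
          <= (C * upperD delta)%:E)%E)
  /\
  (* and such an n can be chosen with at most N coefficients used *)
  (exists d1 d2 : R, [/\ 0 < d1, 0 < d2 &
     forall (delta : R) (N : nat), 0 < delta < 1 ->
       c1 * X delta <= N%:R <= c2 * X delta ->
       exists n : nat, d1 * Y delta <= n%:R <= d2 * Y delta /\
         (#|` hyperbolic_cross r n| <= N)%N]).
Proof.
have s0 : 0 < s by exact: lt_le_trans hs.
have si0 : 0 < s^-1 by rewrite invr_gt0.
have si1 : s^-1 <= 1 by rewrite invf_le1.
have r1 : (1 : R) <= r%:R by rewrite ler1n.
have [rho0 rho1] : 0 <= recip p /\ recip p <= 1.
  case: p hp => [p'| |] p1; [|by split; rewrite /= ?lexx ?ler01|by []].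
  move: p1; rewrite lee_fin => p1; have p0 : 0 < p' by exact: lt_le_trans p1.
  by rewrite invr_ge0 (ltW p0) invf_le1.
pose kappa := recip p - s^-1.
have kappa1 : `|kappa| <= 1.
  by rewrite ler_norml /kappa; apply/andP; split; lra.
have a0 : 0 < mu - recip p + s^-1 by lra.
have mu0 : 0 < mu by lra.
have b0 : 0 < mu - 2 * r%:R + s^-1 - 2^-1 by lra.
have g0 : 0 <= 2 * r%:R - 2^-1 :> R by lra.
have k0 : 0 <= mu - 2 * r%:R + s^-1 - 2^-1 + 3 / 2 - s^-1 by lra.
have kE : mu - 2 * r%:R + 1 = mu - 2 * r%:R + s^-1 - 2^-1 + 3 / 2 - s^-1 by lra.
have gE : 2 * r%:R - 2^-1 + 1 - recip p - (mu - recip p + s^-1)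
  = - (mu - 2 * r%:R + s^-1 - 2^-1) by lra.
have amu : mu - recip p + s^-1 = mu - kappa by rewrite /kappa; ring.
have expN : - mu + 2 * r%:R - s^-1 + 2^-1 = - (mu - 2 * r%:R + s^-1 - 2^-1) by ring.
move=> a b L X Y lowerN upperN lowerD upperD c1 c2 c10 c20.
rewrite -/a -/b in a0 b0 k0 kE gE amu expN.
have [l0 [l00 l01 hl0]] := Lof_bounded_below a0 mu0 c20.
have Ngt0 delta N : 0 < delta < 1 -> c1 * X delta <= N%:R <= c2 * X delta ->
    (0 < N)%N /\ l0 <= Lof delta.
  move=> hd /andP[h1 h2].
  have N0 : (0 < N)%N.
    by rewrite -(ltr_nat R); apply: lt_le_trans h1; rewrite mulr_gt0 // Xof_gt0.
  split=> //; apply: hl0 => //; apply: le_trans h2; by rewrite ler1n.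
have upperDE delta : 0 < delta < 1 ->
    upperD delta = Yof a kappa delta `^ (- b) * Lof delta `^ (3 / 2 - s^-1).
  move=> hd; rewrite -(powR_div_Yof kappa a0 b hd) /upperD /kappa opprB //.
have lowerDE delta : 0 < delta < 1 -> lowerD delta = Xof a mu delta `^ (- b).
  by move=> hd; rewrite /lowerD; exact: (powR_div_Xof mu a0 b hd).
have [C2 [C20 hC2]] := upper_rates_le a0 mu0 amu (ltW b0) k0 l00 c10 c20.
have upDN delta N : 0 < delta < 1 -> c1 * X delta <= N%:R <= c2 * X delta -> (1 < N)%N ->
    upperD delta <= C2 * upperN N.
  move=> hd hN N1; have [N0 hL] := Ngt0 _ _ hd hN.
  rewrite upperDE // /upperN expN.
  rewrite kE.
  exact: hC2.
have upperD0 delta : 0 < delta < 1 -> 0 <= upperD delta.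
  by move=> hd; rewrite upperDE // mulr_ge0 ?powR_ge0.
have trunc d1 d2 : 0 < d1 -> 0 < d2 -> exists C : R, 0 < C /\
   forall delta N n, 0 < delta < 1 -> c1 * X delta <= N%:R <= c2 * X delta ->
     d1 * Y delta <= n%:R <= d2 * Y delta ->
     ((1 < N)%N -> (method_error r s mu p delta (@truncation R r n) <= (C * upperN N)%:E)%E) /\
     (method_error r s mu p delta (@truncation R r n) <= (C * upperD delta)%:E)%E.
  move=> d10 d20.
  have [C0 [C00 hC0]] := @method_error_truncation_le R r hr s mu hs hmu.
  have [C1 [C10 hC1]] := @truncation_rate R a kappa a0 kappa1 b (2 * r%:R - 2^-1) (recip p) s^-1 l0 d1 d2 r
    (ltW b0) g0 rho1 si1 erefl gE l00 d10 d20 hr.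
  (* One constant serves both forms: C0 C1 for the bound in delta, C0 C1 C2 after its conversion to
     N. *)
  exists (C0 * C1 + C0 * C1 * C2); split; first by rewrite addr_gt0 ?mulr_gt0.
  move=> delta N n hd hN hn; have [N0 hL] := Ngt0 _ _ hd hN.
  have /andP[dp _] := hd.
  have n0 : (0 < n)%N.
    have /andP[h _] := hn; rewrite -(ltr_nat R); apply: lt_le_trans h.
    by rewrite mulr_gt0 // Yof_gt0.
  have main : (method_error r s mu p delta (@truncation R r n) <= (C0 * C1 * upperD delta)%:E)%E.
    apply: le_trans (hC0 p delta n hp dp n0) _.
    rewrite lee_fin -mulrA ler_wpM2l ?(ltW C00) // upperDE //.
    exact: hC1.
  have C01 : 0 < C0 * C1 by rewrite mulr_gt0.
  split=> [N1|]; apply: le_trans main _; rewrite lee_fin.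
    have h := upDN _ _ hd hN N1.
    have uN : 0 <= upperN N by rewrite -(pmulr_rge0 _ C20) (le_trans (upperD0 _ hd)).
    have uD := upperD0 _ hd.
    apply: (@le_trans _ _ (C0 * C1 * (C2 * upperN N))); first by rewrite ler_wpM2l ?(ltW C01).
    by rewrite mulrA ler_wpM2r // lerDr ltW.
  by rewrite ler_wpM2r ?upperD0 // lerDl ltW // mulr_gt0.
have [e1 [e2 [e10 e20 choice_n]]] := cross_size_choice a0 amu kappa1 hr l00 c10.
split; [|split => //].
- have [C [C0 hC]] := trunc e1 e2 e10 e20.
  have [c [c0 hc]] := galerkin_radius_ge hr hs (ltW mu0).
  (* The second entry converts N to X: as N <= c2 X and the exponent - b is negative, N^(- b) >=
     c2^(- b) X^(- b). *)
  exists (Num.min c (c * c2 `^ (- b))), C; split => //.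
    by rewrite lt_min c0 mulr_gt0 // powR_gt0.
  move=> delta N hd hN; have [N0 hL] := Ngt0 _ _ hd hN.
  have /andP[dp _] := hd; have /andP[h1 h2] := hN.
  have Np : 0 < N%:R :> R by rewrite ltr0n.
  have X0 : 0 < X delta by exact: Xof_gt0.
  have low := hc p N delta hp N0 (ltW dp).
  have [n [n0 hn cn]] := choice_n delta N hd hL N0 h1.
  have [u1 u2] := hC delta N n hd hN hn.
  have rad : (galerkin_radius r s mu p N delta <= method_error r s mu p delta (@truncation R r n))%E.
    apply: ereal_inf_lbound; exists (hyperbolic_cross r n), (@truncation R r n); split => //.
      move=> i; rewrite /hyperbolic_cross; move: [seq _ | _ <- _, _ <- _] => S.
      by rewrite !inE => /andP[_ /and3P[-> ->]].
    exact: inL2_truncation.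
  split.
  + apply: le_trans low; rewrite lee_fin ler_wpM2r ?powR_ge0 // ge_min lexx //.
  + by move=> N1; apply: le_trans rad (u1 N1).
  + apply: le_trans low; rewrite lee_fin expN lowerDE //.
    apply: (@le_trans _ _ (c * c2 `^ (- b) * Xof a mu delta `^ (- b))).
      by rewrite ler_wpM2r ?powR_ge0 // ge_min lexx orbT.
    rewrite -mulrA ler_wpM2l ?(ltW c0) // -powRM ?(ltW c20) ?(ltW X0) //.
    by apply: le_powR_neg => //; exact: ltW.
  + exact: le_trans rad u2.
- exists e1, e2; split => // delta N hd hN; have [N0 hL] := Ngt0 _ _ hd hN.
  have /andP[h1 _] := hN.
  by have [n [_ hn cn]] := choice_n delta N hd hL N0 h1; exists n.
Qed.
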